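(* Let $B_{-1},B_0,B_1$ be entrywise nonnegative $n\times n$ matrices with $(B_{-1}+B_0+B_1)\mathbf 1=\mathbf 1$, and set $A_{-1}=-B_{-1}$, $A_0=I-B_0$, $A_1=-B_1$, with $A_0$ invertible. Let $G$ and $V$ be the minimal nonnegative solutions of $$A_1G^2+A_0G+A_{-1}=0,\qquad A_{-1}V^2+A_0V+A_1=0.$$ Assume recurrence, that is, $G\mathbf 1=\mathbf 1$, and that $\lambda=1$ is the only eigenvalue of modulus $1$ of $G$. Let $\sigma=\rho(G)$, $\tau=\rho(V)$, let the eigenvalues of $G$ be ordered as $1=\lambda_1>|\lambda_2|\ge\cdots\ge|\lambda_n|$, and let $\tilde\sigma=|\lambda_2|$ be the second largest modulus of the eigenvalues of $G$. Let $\widetilde G$ be a stochastic matrix, set $H=G-\widetilde G$, and apply the SDA iteration with initial values $$P_0=-(A_0+A_1\widetilde G)^{-1}(A_1\widetilde G^2+A_0\widetilde G+A_{-1}),\quad E_0=\widetilde G+P_0,\quad F_0=Q_0=-(A_0+A_1\widetilde G)^{-1}A_1.$$ Then: (a) $H\mathbf 1=0$ and $(H-P_k)\mathbf 1=F_kH\mathbf 1=0$; this implies that the matrices $P_k$ are stochastic for any $k$ and that there is no error in the approximation $P_k$ to $H$ along the direction given by $\mathbf 1$. (b) If $w$ is any other eigenvector of $G$, corresponding to an eigenvalue $\lambda\ne1$, then $F_kHG^{2^k}w=\lambda^{2^k}F_kHw$, where $H-P_k=F_kHG^{2^k}$. (c) If $G$ has $n$ linearly independent eigenvectors corresponding to $\lambda_1,\ldots,\lambda_n$,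 then there exists a constant $\gamma$ such that $\|HG^{2^k}w\|\le\gamma|\lambda_2|^{2^k}\|w\|$ for any vector $w$; that is, $\|H-P_k\|\le\tilde\gamma(\tau\tilde\sigma)^{2^k}$ for a constant $\tilde\gamma$. This implies $$\limsup_k\|H-P_k\|^{1/2^k}\le\tau\tilde\sigma<\tau\sigma.$$ The same conclusion holds when $G$ has nontrivial Jordan blocks. (d) Superlinear convergence is still guaranteed if the process is null recurrent, i.e., $\rho(V)=\rho(G)=1$.
   Context: $n\in\mathbb N\cup\{\infty\}$, $I$ is the identity matrix, $\mathbf 1=(1,1,\ldots)^T$ is the vector of all ones, $\rho(\cdot)$ is the spectral radius, and $\|\cdot\|$ is an operator norm (and the corresponding vector norm). A stochastic matrix is an entrywise nonnegative matrix $A$ with $A\mathbf 1=\mathbf 1$. A minimal nonnegative solution is an entrywise nonnegative solution that is entrywise less than or equal to every other entrywise nonnegative solution. The process is the Quasi-Birth-and-Death Markov chain whose homogeneous part of the transition matrix is defined by $B_{-1},B_0,B_1$. The SDA (Structure-preserving Doubling Algorithm) iteration with initial matrices $E_0,F_0,P_0,Q_0$ is, for $k=0,1,\ldots$, $$E_{k+1}=E_k(I-Q_kP_k)^{-1}E_k,\qquad P_{k+1}=P_k+F_k(I-P_kQ_k)^{-1}P_kE_k,$$ $$F_{k+1}=F_k(I-P_kQ_k)^{-1}F_k,\qquad Q_{k+1}=Q_k+E_k(I-Q_kP_k)^{-1}Q_kF_k,$$ where $I-P_kQ_k$ and $I-Q_kP_k$ are assumed to be invertible for $k=0,1,\ldots$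 (no breakdown).
   Formalization: n is finite; in (a) the stochastic matrices are G̃+P_k (P_k 1=0, so P_k cannot be); in (c) the strict inequality τσ̃<τσ assumes τ>0, and the bound γ̃(τσ̃)^{2^k} assumes ‖V^j‖≤cτ^j for all j (it fails if V has Jordan blocks at modulus τ). *)

(* Defs.v *)
From mathcomp Require Import all_boot all_order all_algebra.
From mathcomp Require Export complex.
From mathcomp Require Import all_classical all_reals all_analysis.

Set Implicit Arguments.
Unset Strict Implicit.
Unset Printing Implicit Defensive.

Import Order.TTheory GRing.Theory Num.Theory.
Import numFieldNormedType.Exports.

Local Open Scope classical_set_scope.
Local Open Scope ring_scope.

Definition vec1 (R : pzRingType) (n : nat) : 'cV[R]_n := const_mx 1.

Definition nonneg_mx (R : numDomainType) (m n : nat) (A : 'M[R]_(m, n)) : Prop :=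
  A \is a mxOver Num.nneg.

Definition stochastic (R : numDomainType) (n : nat) (A : 'M[R]_n) : Prop :=
  nonneg_mx A /\ A *m vec1 R n = vec1 R n.

Definition quad_solution (R : pzRingType) (n : nat) (X2 X1 X0 : 'M[R]_n)
    (X : 'M[R]_n) : Prop :=
  X2 *m X *m X + X1 *m X + X0 = 0.

Definition minimal_nonneg_solution (R : numDomainType) (n : nat)
    (S : 'M[R]_n -> Prop) (X : 'M[R]_n) : Prop :=
  [/\ nonneg_mx X, S X &
    forall Y, nonneg_mx Y -> S Y -> forall i j, X i j <= Y i j].

(* Complex modulus as an element of R; `|z| itself has type R[i]. *)
Definition cmod (R : rcfType) (z : R[i]) : R := complex.Re `|z|.

Definition cmx (R : rcfType) (m n : nat) (A : 'M[R]_(m, n)) : 'M[R[i]]_(m, n) :=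
  map_mx (real_complex R) A.

(* [eigenvalue] is defined through row eigenvectors; the spectrum is the same. *)
Definition spectral_radius (R : realType) (n : nat) (A : 'M[R]_n) : R :=
  sup [set r : R | exists2 z : R[i], eigenvalue (cmx A) z & r = cmod z].

(* Norms on C^n. Working over C loses no real operator norm: every norm on R^n
   extends to C^n (Taylor complexification) with the same induced norm on real
   matrices. *)
Definition vector_norm (R : rcfType) (n : nat) (N : 'cV[R[i]]_n -> R) : Prop :=
  [/\ forall x, N x = 0 -> x = 0,
      forall x y, N (x + y) <= N x + N y &
      forall (a : R[i]) x, N (a *: x) = cmod a * N x].

Definition opnorm (R : realType) (n : nat) (N : 'cV[R[i]]_n -> R)
    (A : 'M[R]_n) : R :=
  sup [set N (cmx A *m x) | x in [set x : 'cV[R[i]]_n | N x <= 1]].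

(* The two invertibility clauses (no breakdown) keep invmx from taking its junk
   value on singular matrices. *)
Definition SDA (R : fieldType) (n : nat) (E F P Q : nat -> 'M[R]_n) : Prop :=
  forall k : nat,
  [/\ 1%:M - Q k *m P k \in unitmx,
      1%:M - P k *m Q k \in unitmx &
    [/\ E k.+1 = E k *m invmx (1%:M - Q k *m P k) *m E k,
        F k.+1 = F k *m invmx (1%:M - P k *m Q k) *m F k,
        P k.+1 = P k + F k *m invmx (1%:M - P k *m Q k) *m P k *m E k &
        Q k.+1 = Q k + E k *m invmx (1%:M - Q k *m P k) *m Q k *m F k]].

(* Q-superlinear convergence to 0 of a sequence of errors; written without the
   quotient e_(k+1) / e_k so that the errors may vanish. *)
Definition superlinear_to0 (R : realType) (e : nat -> R) : Prop :=
  e @ \oo --> (0 : R) /\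
  forall eps : R, 0 < eps -> \forall k \near \oo, `|e k.+1| <= eps * `|e k|.

(* Main.v *)
From HB Require Import structures.
Require Import Defs.
From mathcomp Require Import all_boot all_order all_algebra.
From mathcomp Require Import all_classical all_reals all_analysis.
From mathcomp Require Import ring lra zify.

Set Implicit Arguments.
Unset Strict Implicit.
Unset Printing Implicit Defensive.

Import Order.TTheory GRing.Theory Num.Theory.
Import numFieldNormedType.Exports.

Local Open Scope classical_set_scope.
Local Open Scope ring_scope.

(** Write B(-1), B0, B1 for the blocks (Bm, B0, Bp below) of the level process.
    A sequence x is harmonic when Bm x_j + B0 x_(j+1) + Bp x_(j+2) = x_(j+1).
    Along such a sequence put y_j = x_(j+1) - Gt x_j.  The whole proof rests on
    one remark: the matrices of step k relate the two ends of a block of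
    N = 2^k levels,
        E_k x_0 = x_N - Q_k y_N,      y_0 - P_k x_0 = F_k y_N,
    whatever harmonic sequence is put in ([SDA_transfer], by doubling).  The
    sequence G^j gives H - P_k = F_k H G^N ([SDA_error]), hence (a), up to
    nonnegativity, and (b), since H 1 = 0.  As H 1 = 0, the factor H G^N only
    sees G with its eigenvalue 1 deflated and decays like |lambda_2|^N
    ([deflated_growth], [diagonalizable_growth]).

    What is left is to control F_k.  The downward sequence V^(N+1-j) gives
    F_k (I - Gt V) = (I - (Gt + P_k) V) V^N ([F_down]), and the matrices
    Gt + P_k are stochastic: their columns are the values at level 1 of a
    harmonic function on N levels, reflected by Gt at the top, which is
    nonnegative by a minimum principle ([SDA_stochastic]).  The absence of
    breakdown implies that the reflected chain has no trap ([SDA_unique],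
    [no_trap]).

    If tau < 1, a row y with y Gt V = y would produce a closed class of the
    reflected chain ([trap]), so I - Gt V is invertible and F_k = O(V^N).

    If tau = 1, then I - Gt V is singular, V is stochastic with 1 as only
    unimodular eigenvalue ([unimodular_V]: bounded harmonic sequences are
    governed by G alone, by the maximum principle of a recurrent chain,
    [maximum_principle]), and the mean drift vanishes ([recurrent_drift]), so
    that there is a harmonic sequence u + j 1.  It gives a second relation
    F_k (1 + u - Gt u) = 1 + u - (Gt + P_k) u ([F_drift]).  The n x (n+1)
    matrix [I - Gt V, 1 + u - Gt u] has independent rows
    ([recurrent_row_free]), so F_k stays bounded, which is the rate tau^N.

    For (d), H - P_(k+1) = Psi_k (H - P_k) G^N with
    Psi_k = F_k (I - P_k Q_k)^-1, and (H - P_k) 1 = 0 makes the last product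
    o(H - P_k).  The matrix Psi_k is the analogue of F_k for a chain reflected
    by Gt + P_k, which tends to G; the same rank statement, now for G in place
    of Gt, bounds Psi_k ([Psi_bound_recurrent]). *)


(** * Doubling as transfer along level sequences *)

Lemma entryD (R : pzRingType) m n (A B : 'M[R]_(m, n)) i j :
  (A + B) i j = A i j + B i j.
Proof. by rewrite mxE. Qed.

Lemma entryN (R : pzRingType) m n (A : 'M[R]_(m, n)) i j : (- A) i j = - A i j.
Proof. by rewrite mxE. Qed.

Lemma entryZ (R : pzRingType) m n c (A : 'M[R]_(m, n)) i j :
  (c *: A) i j = c * A i j.
Proof. by rewrite mxE. Qed.

Ltac mx_abel :=
  apply/matrixP => ? ?; rewrite ?(entryD, entryN, entryZ); ring.

Section Harmonic.
Variables (R : fieldType) (n : nat) (Bm B0 Bp : 'M[R]_n).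

Definition harmonic_at (m : nat) (x : nat -> 'M[R]_(n, m)) (j : nat) : Prop :=
  Bm *m x j + B0 *m x j.+1 + Bp *m x j.+2 = x j.+1.

(** A solution of the quadratic equation moves one level down, so its powers
    form a harmonic sequence. *)
Lemma harmonic_expr (X : 'M[R]_n) :
  X = Bm + B0 *m X + Bp *m X *m X ->
  forall j, harmonic_at (fun j => X ^+ j) j.
Proof.
move=> eX j; rewrite /harmonic_at !exprS.
have -> : X * (X * X ^+ j) = X *m X *m X ^+ j by rewrite -mulmxA.
have -> : X * X ^+ j = X *m X ^+ j by [].
by rewrite !mulmxA -!mulmxDl -eX.
Qed.

End Harmonic.

Section Doubling.
Variables (R : fieldType) (n : nat) (Bm B0 Bp Gt : 'M[R]_n).
Variables (E F P Q : nat -> 'M[R]_n).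
Let M := 1%:M - B0 - Bp *m Gt.
Hypothesis unitM : M \in unitmx.
Hypothesis P0E : M *m P 0%N = Bp *m Gt *m Gt + (B0 - 1%:M) *m Gt + Bm.
Hypothesis E0E : E 0%N = Gt + P 0%N.
Hypothesis F0E : M *m F 0%N = Bp.
Hypothesis Q0E : Q 0%N = F 0%N.
Hypothesis hSDA : SDA E F P Q.

Let y (m : nat) (x : nat -> 'M[R]_(n, m)) j := x j.+1 - Gt *m x j.

(** Gluing a second block on top amounts to replacing the boundary value y_N
    by the defect y_N - P_k x_N. *)
Lemma SDA_reflect (m k : nat) (x0 xN yN y0 : 'M[R]_(n, m)) :
  E k *m x0 = xN - Q k *m yN -> y0 - P k *m x0 = F k *m yN ->
  y0 - P k.+1 *m x0 =
    F k *m invmx (1%:M - P k *m Q k) *m (yN - P k *m xN).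
Proof.
move=> h1 h2; have [_ uPQ [_ _ -> _]] := hSDA k.
have e : (1%:M - P k *m Q k) *m yN = (yN - P k *m xN) + P k *m E k *m x0.
  by rewrite mulmxBl mul1mx -!mulmxA h1 mulmxBr; mx_abel.
have e' : yN = invmx (1%:M - P k *m Q k) *m
    ((yN - P k *m xN) + P k *m E k *m x0).
  by rewrite -e mulKmx.
rewrite mulmxDl opprD addrA h2 {1}e' -!mulmxA !mulmxDr.
by mx_abel.
Qed.

Lemma SDA_step (m k : nat) (x0 xN yN x2 y2 y0 : 'M[R]_(n, m)) :
  E k *m x0 = xN - Q k *m yN -> y0 - P k *m x0 = F k *m yN ->
  E k *m xN = x2 - Q k *m y2 -> yN - P k *m xN = F k *m y2 ->
  E k.+1 *m x0 = x2 - Q k.+1 *m y2 /\ y0 - P k.+1 *m x0 = F k.+1 *m y2.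
Proof.
move=> h1 h2 h3 h4; have [uQP uPQ [EE FE _ QE]] := hSDA k.
split; last by rewrite (SDA_reflect h1 h2) h4 FE !mulmxA.
have e1 : (1%:M - Q k *m P k) *m xN = E k *m x0 + Q k *m F k *m y2.
  by rewrite mulmxBl mul1mx h1 -!mulmxA -h4 mulmxBr; mx_abel.
have e1' : xN = invmx (1%:M - Q k *m P k) *m (E k *m x0 + Q k *m F k *m y2).
  by rewrite -e1 mulKmx.
have e4 : E k *m xN = E k *m invmx (1%:M - Q k *m P k) *m E k *m x0 +
  E k *m invmx (1%:M - Q k *m P k) *m Q k *m F k *m y2.
  by rewrite {1}e1' !mulmxDr !mulmxA.
by rewrite EE QE mulmxDl opprD addrA -h3 e4; mx_abel.
Qed.

(** The initial matrices solve the recurrence at a single level for its upper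
    and lower values. *)
Lemma SDA_base m (x : nat -> 'M[R]_(n, m)) j : harmonic_at Bm B0 Bp x j ->
  E 0%N *m x j = x j.+1 - Q 0%N *m y x j.+1 /\
  y x j - P 0%N *m x j = F 0%N *m y x j.+1.
Proof.
rewrite /harmonic_at => hx.
have e : y x j - P 0%N *m x j = F 0%N *m y x j.+1.
  rewrite -[LHS](mulKmx unitM) -[RHS](mulKmx unitM); congr (_ *m _).
  rewrite !mulmxA F0E mulmxBr mulmxA P0E /y.
  have -> : Bp *m (x j.+2 - Gt *m x j.+1) = 
            M *m x j.+1 - Bm *m x j.
    have hx' : Bp *m x j.+2 = x j.+1 - Bm *m x j - B0 *m x j.+1.
      transitivity ((Bm *m x j + B0 *m x j.+1 + Bp *m x j.+2)
        - Bm *m x j - B0 *m x j.+1); first by mx_abel.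
      by rewrite hx.
    by rewrite /M !mulmxBl mul1mx mulmxBr mulmxA hx'; mx_abel.
  rewrite /M !(mulmxBl, mulmxBr, mulmxDl, mulmxDr, mul1mx, mulNmx) !mulmxA.

  by mx_abel.
split=> //; rewrite E0E Q0E mulmxDl -e /y.
by mx_abel.
Qed.

(** Two consecutive blocks of 2^k levels share the middle values x_N and y_N;
    eliminating these is the doubling step. *)
Lemma SDA_transfer m (x : nat -> 'M[R]_(n, m)) k j :
  (forall l, (j <= l < j + 2 ^ k)%N -> harmonic_at Bm B0 Bp x l) ->
  E k *m x j = x (j + 2 ^ k)%N - Q k *m y x (j + 2 ^ k)%N /\
  y x j - P k *m x j = F k *m y x (j + 2 ^ k)%N.
Proof.
elim: k j => [|k IH] j hx.
  by rewrite addn1; apply: SDA_base; apply: hx; rewrite leqnn addn1 /=.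
have p2 : (2 ^ k.+1 = 2 ^ k + 2 ^ k)%N by rewrite expnS mul2n addnn.
have [h1 h2] : _ /\ _ := IH j (fun l hl => hx l ltac:(lia)).
have [h3 h4] : _ /\ _ := IH (j + 2 ^ k)%N (fun l hl => hx l ltac:(lia)).
by rewrite p2 addnA; exact: SDA_step h1 h2 h3 h4.
Qed.

(** The form of [SDA_transfer] in which the top of the block is reflected by
    Gt + P_k instead of Gt. *)
Lemma SDA_transfer_reflect m (x : nat -> 'M[R]_(n, m)) k :
  (forall l, (l < 2 ^ k)%N -> harmonic_at Bm B0 Bp x l) ->
  y x 0%N - P k.+1 *m x 0%N =
    F k *m invmx (1%:M - P k *m Q k) *m
      (x (2 ^ k).+1 - (Gt + P k) *m x (2 ^ k)%N).
Proof.
move=> hx; have [h1 h2] : _ /\ _ := @SDA_transfer _ x k 0%N hx.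
rewrite add0n in h1 h2; rewrite (SDA_reflect h1 h2).
by rewrite /y mulmxDl opprD addrA.
Qed.

(** Zero data at both ends propagates to the middle of the block because I -
    Q_k P_k is invertible, and then to both halves. *)
Lemma SDA_unique m (x : nat -> 'M[R]_(n, m)) k j :
  (forall l, (j <= l < j + 2 ^ k)%N -> harmonic_at Bm B0 Bp x l) ->
  x j = 0 -> y x (j + 2 ^ k)%N = 0 ->
  forall l, (j <= l <= j + 2 ^ k)%N -> x l = 0 /\ y x l = 0.
Proof.
elim: k j => [|k IH] j hx x0 y0 l hl.
  have [h1 h2] := SDA_transfer hx.
  rewrite x0 y0 !mulmx0 ?subr0 in h1 h2.
  have [->|->] : (l = j \/ l = j + 2 ^ 0)%N by rewrite expn0 in hl *; lia.
    by split.
  by split.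
have p2 : (2 ^ k.+1 = 2 ^ k + 2 ^ k)%N by rewrite expnS mul2n addnn.
have [h1 h2] : _ /\ _ := @SDA_transfer _ x k j (fun l hl => hx l ltac:(lia)).
have [h3 h4] : _ /\ _ := @SDA_transfer _ x k (j + 2 ^ k)%N (fun l hl => hx l ltac:(lia)).
have [uQP uPQ _] := hSDA k.
move: h1 h4; rewrite -addnA -p2 y0 x0 !mulmx0 => /esym h1 h4.
have x1 : x (j + 2 ^ k)%N = 0.
  rewrite -[LHS](mulKmx uQP) mulmxBl mul1mx -mulmxA.
  by rewrite -(subr0_eq h4) h1 mulmx0.
have y1 : y x (j + 2 ^ k)%N = 0 by rewrite (subr0_eq h4) x1 mulmx0.
have [hl1|hl1] := leqP l (j + 2 ^ k)%N.
  apply: (IH j) => //; last by lia.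
  by move=> i hi; apply: hx; lia.
apply: (IH (j + 2 ^ k)%N) => //; last by lia.
- by move=> i hi; apply: hx; lia.
- by rewrite -addnA -p2.
Qed.

End Doubling.

(** * Minimal solutions and the maximum principle of a recurrent chain *)

Definition lemx (R : numDomainType) m n (A B : 'M[R]_(m, n)) : Prop :=
  forall i j, A i j <= B i j.

Notation "A <=m B" := (lemx A B) (at level 70, no associativity).

Section EntrywiseOrder.
Variable R : realDomainType.

Lemma nonneg_mxP m n (A : 'M[R]_(m, n)) :
  nonneg_mx A <-> forall i j, 0 <= A i j.
Proof.
split=> [/mxOverP h i j|h]; first by have := h i j; rewrite nnegrE.
by apply/mxOverP => i j; rewrite nnegrE.
Qed.

Lemma nonneg_mxE m n (A : 'M[R]_(m, n)) : nonneg_mx A <-> 0 <=m A.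
Proof.
by rewrite nonneg_mxP; split=> h i j; have := h i j; rewrite mxE.
Qed.

Lemma lemx_refl m n (A : 'M[R]_(m, n)) : A <=m A.
Proof. by move=> i j. Qed.

Lemma lemx_trans m n (B A C : 'M[R]_(m, n)) : A <=m B -> B <=m C -> A <=m C.
Proof. by move=> h1 h2 i j; exact: le_trans (h1 i j) (h2 i j). Qed.

Lemma lemx_anti m n (A B : 'M[R]_(m, n)) : A <=m B -> B <=m A -> A = B.
Proof. by move=> h1 h2; apply/matrixP => i j; apply/le_anti/andP; split. Qed.

Lemma lemxD m n (A B C D : 'M[R]_(m, n)) :
  A <=m B -> C <=m D -> A + C <=m B + D.
Proof. by move=> h1 h2 i j; rewrite !entryD lerD. Qed.

Lemma lemxN m n (A B : 'M[R]_(m, n)) : A <=m B -> - B <=m - A.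
Proof. by move=> h i j; rewrite !entryN lerN2. Qed.

Lemma lemxMl m n p (A : 'M[R]_(m, n)) (B C : 'M[R]_(n, p)) :
  nonneg_mx A -> B <=m C -> A *m B <=m A *m C.
Proof.
move=> /nonneg_mxP hA h i j; rewrite !mxE; apply: ler_sum => k _.
exact: ler_wpM2l.
Qed.

Lemma lemxMr m n p (A B : 'M[R]_(m, n)) (C : 'M[R]_(n, p)) :
  nonneg_mx C -> A <=m B -> A *m C <=m B *m C.
Proof.
move=> /nonneg_mxP hC h i j; rewrite !mxE; apply: ler_sum => k _.
exact: ler_wpM2r.
Qed.

Lemma nonneg_mx0 m n : nonneg_mx (0 : 'M[R]_(m, n)).
Proof. by apply/nonneg_mxP => i j; rewrite mxE. Qed.

Lemma nonneg_mx1 n : nonneg_mx (1%:M : 'M[R]_n).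
Proof. by apply/nonneg_mxP => i j; rewrite mxE ler0n. Qed.

Lemma nonneg_mxD m n (A B : 'M[R]_(m, n)) :
  nonneg_mx A -> nonneg_mx B -> nonneg_mx (A + B).
Proof.
move=> /nonneg_mxP a /nonneg_mxP b; apply/nonneg_mxP => i j.
by rewrite mxE addr_ge0.
Qed.

Lemma nonneg_mxM m n p (A : 'M[R]_(m, n)) (B : 'M[R]_(n, p)) :
  nonneg_mx A -> nonneg_mx B -> nonneg_mx (A *m B).
Proof.
move=> /nonneg_mxP a /nonneg_mxP b; apply/nonneg_mxP => i j.
by rewrite mxE sumr_ge0 // => k _; rewrite mulr_ge0.
Qed.

Lemma nonneg_mxX n (A : 'M[R]_n) k : nonneg_mx A -> nonneg_mx (A ^+ k).
Proof.
move=> hA; elim: k => [|k IH]; first by rewrite expr0; exact: nonneg_mx1.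
by rewrite exprS; exact: nonneg_mxM.
Qed.

Lemma nonneg_vec1 n : nonneg_mx (vec1 R n).
Proof. by apply/nonneg_mxP => i j; rewrite mxE. Qed.

Lemma row_sumE n (A : 'M[R]_n) i : (A *m vec1 R n) i 0 = \sum_j A i j.
Proof. by rewrite mxE; apply: eq_bigr => j _; rewrite mxE mulr1. Qed.

Lemma expr_vec1 n (A : 'M[R]_n) k :
  A *m vec1 R n = vec1 R n -> A ^+ k *m vec1 R n = vec1 R n.
Proof.
move=> h; elim: k => [|k IH]; first by rewrite expr0 mul1mx.
by rewrite exprS -mulmxA IH.
Qed.

Lemma expr_sub_vec1 n (A : 'M[R]_n) k : nonneg_mx A ->
  A *m vec1 R n <=m vec1 R n -> A ^+ k *m vec1 R n <=m vec1 R n.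
Proof.
move=> hA h; elim: k => [|k IH].
  by rewrite expr0 mul1mx; exact: lemx_refl.
rewrite exprS -mulmxA; apply: lemx_trans h; exact: lemxMl.
Qed.

Lemma mul_sto_bound n (A : 'M[R]_n) (x : 'cV[R]_n) (C : R) : nonneg_mx A ->
  A *m vec1 R n = vec1 R n -> (forall i, x i 0 <= C) ->
  forall i, (A *m x) i 0 <= C.
Proof.
move=> /nonneg_mxP hA h hx i; rewrite mxE.
apply: (@le_trans _ _ (\sum_j A i j * C)).
  by apply: ler_sum => j _; exact: ler_wpM2l.
by rewrite -mulr_suml -row_sumE h mxE mul1r.
Qed.

End EntrywiseOrder.

Lemma cvgn_sum (R : realType) (I : Type) (r : seq I) (f : I -> nat -> R) l :
  (forall i, f i @ \oo --> (l i : R)) ->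
  (fun m => \sum_(i <- r) f i m) @ \oo --> \sum_(i <- r) l i.
Proof.
move=> h; elim: r => [|a r IH].
  under eq_fun do rewrite big_nil.
  by rewrite big_nil; exact: cvg_cst.
under eq_fun do rewrite big_cons.
by rewrite big_cons; apply: cvgD.
Qed.

Lemma cvgn_mulmx (R : realType) m n p (A : nat -> 'M[R]_(m, n))
    (B : nat -> 'M[R]_(n, p)) (A' : 'M[R]_(m, n)) (B' : 'M[R]_(n, p)) :
  (forall i j, (fun k => A k i j) @ \oo --> (A' i j : R)) ->
  (forall i j, (fun k => B k i j) @ \oo --> (B' i j : R)) ->
  forall i j, (fun k => (A k *m B k) i j) @ \oo --> ((A' *m B') i j : R).
Proof.
move=> hA hB i j; under eq_fun do rewrite mxE.
by rewrite mxE; apply: cvgn_sum => k; apply: cvgM.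
Qed.

Lemma cvgn_mulmx_const (R : realType) m n p (A : nat -> 'M[R]_(m, n))
    (A' : 'M[R]_(m, n)) (B : 'M[R]_(n, p)) :
  (forall i j, (fun k => A k i j) @ \oo --> (A' i j : R)) ->
  forall i j, (fun k => (A k *m B) i j) @ \oo --> ((A' *m B) i j : R).
Proof. by move=> hA; apply: cvgn_mulmx => // i j; exact: cvg_cst. Qed.

Section MinimalSolution.
Variables (R : realType) (n : nat) (Bm B0 Bp G : 'M[R]_n).
Hypothesis hBm : nonneg_mx Bm.
Hypothesis hB0 : nonneg_mx B0.
Hypothesis hBp : nonneg_mx Bp.
Hypothesis hB : (Bm + B0 + Bp) *m vec1 R n = vec1 R n.

Definition qbd_solution (X : 'M[R]_n) := X = Bm + B0 *m X + Bp *m X *m X.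

Hypothesis hG : minimal_nonneg_solution qbd_solution G.

(** Starting from 0, this iteration increases to the minimal nonnegative
    solution. *)
Fixpoint natural_iter (m : nat) : 'M[R]_n :=
  if m is m'.+1 then
    Bm + B0 *m natural_iter m' + Bp *m natural_iter m' *m natural_iter m'
  else 0.
Let Y := natural_iter.

Lemma natural_iter_nonneg m : nonneg_mx (Y m).
Proof.
by elim: m => [|m IH] /=; do ?[exact: nonneg_mx0|apply: nonneg_mxD|apply: nonneg_mxM].
Qed.

Lemma qbd_map_mono (X X' : 'M[R]_n) : nonneg_mx X -> X <=m X' ->
  Bm + B0 *m X + Bp *m X *m X <=m Bm + B0 *m X' + Bp *m X' *m X'.
Proof.
move=> hX h; have hX' : nonneg_mx X'.
  by apply/nonneg_mxE; apply: lemx_trans h; exact/nonneg_mxE.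
apply: lemxD; first by apply: lemxD; [exact: lemx_refl|exact: lemxMl].
apply: (@lemx_trans _ _ _ (Bp *m X *m X')).
  by apply: lemxMl => //; exact: nonneg_mxM.
by apply: lemxMr => //; exact: lemxMl.
Qed.

Lemma natural_iter_mono m : Y m <=m Y m.+1.
Proof.
elim: m => [|m IH]; first by apply/nonneg_mxE; exact: natural_iter_nonneg.
by apply: qbd_map_mono => //; exact: natural_iter_nonneg.
Qed.

Lemma natural_iter_le X m : nonneg_mx X -> qbd_solution X -> Y m <=m X.
Proof.
move=> hX eX; elim: m => [|m IH]; first exact/nonneg_mxE.
by rewrite eX; apply: qbd_map_mono => //; exact: natural_iter_nonneg.
Qed.

Lemma natural_iter_sub m : Y m *m vec1 R n <=m vec1 R n.
Proof.
elim: m => [|m IH]; first by rewrite mul0mx; apply/nonneg_mxE; exact: nonneg_vec1.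
rewrite /= -{2}hB !mulmxDl; apply: lemxD; first apply: lemxD.
- exact: lemx_refl.
- by rewrite -mulmxA; exact: lemxMl.
- rewrite -!mulmxA; apply: lemxMl => //; apply: lemx_trans (IH).
  by apply: lemxMl => //; exact: natural_iter_nonneg.
Qed.

(** The monotone limit is itself a solution, and it lies below every
    nonnegative solution. *)
Lemma natural_iter_cvg i j : (fun m => Y m i j) @ \oo --> (G i j : R).
Proof.
have [G0 eG minG] := hG.
have ndY i' j' : nondecreasing_seq (fun m => Y m i' j').
  by apply/nondecreasing_seqP => m; exact: natural_iter_mono.
have cY i' j' : cvgn (fun m => Y m i' j').
  apply: nondecreasing_is_cvgn => //; exists (G i' j') => _ [m _ <-].
  exact: natural_iter_le.
pose L : 'M[R]_n := \matrix_(i', j') limn (fun m => Y m i' j').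
have cL i' j' : (fun m => Y m i' j') @ \oo --> (L i' j' : R).
  by rewrite mxE; exact: cY.
have L0 : nonneg_mx L.
  apply/nonneg_mxP => i' j'; rewrite mxE; apply: limr_ge => //.
  by apply: nearW => m; have /nonneg_mxP := natural_iter_nonneg m.
have eL : qbd_solution L.
  apply/matrixP => i' j'; rewrite !entryD.
  have cS : (fun m => Y m.+1 i' j') @ \oo --> (L i' j' : R).
    by have := cL i' j'; rewrite -(cvg_shiftS (fun m => Y m i' j')).
  rewrite -(cvg_lim _ cS) //; apply/cvg_lim => //.
  under eq_fun do rewrite /= !entryD.
  apply: cvgD; first apply: cvgD; first exact: cvg_cst.
    by apply: cvgn_mulmx => // *; exact: cvg_cst.
  apply: cvgn_mulmx => //; apply: cvgn_mulmx => // *; exact: cvg_cst.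
suff -> : G = L by [].
apply: lemx_anti; first exact: minG.
move=> i' j'; rewrite mxE; apply: limr_le => //.
by apply: nearW => m; exact: natural_iter_le.
Qed.

(** The bound holds for every iterate, hence for their limit G. *)
Lemma minimal_solution_sub : G *m vec1 R n <=m vec1 R n.
Proof.
move=> i j; have cG := @cvgn_mulmx_const _ _ _ _ Y G (vec1 R n) natural_iter_cvg i j.
rewrite -(cvg_lim _ cG) //; apply: limr_le; first by apply: cvgP cG.
by apply: nearW => m; exact: natural_iter_sub.
Qed.

Hypothesis hG1 : G *m vec1 R n = vec1 R n.

Definition subharmonic (f : nat -> 'cV[R]_n) :=
  forall j, f j.+1 <=m Bm *m f j + B0 *m f j.+1 + Bp *m f j.+2.

(** By induction on m, f_(j+1) <= Y_m f_j + C (1 - Y_m 1) for the natural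
    iterates Y_m, uniformly in j; as Y_m tends to G and G 1 = 1, the last term
    vanishes in the limit. *)
Lemma maximum_principle (f : nat -> 'cV[R]_n) (C : R) :
  (forall j i, f j i 0 <= C) -> subharmonic f ->
  forall j, f j.+1 <=m G *m f j.
Proof.
move=> hC hf.
have step m j : f j.+1 <=m Y m *m f j + C *: (vec1 R n - Y m *m vec1 R n).
  elim: m j => [|m IH] j.
    rewrite !mul0mx subr0 add0r => i k; rewrite !ord1 !mxE mulr1; exact: hC.
  have Y0 := natural_iter_nonneg m.
  apply: (lemx_trans (hf j)).
  apply: (@lemx_trans _ _ _ (Bm *m f j
    + B0 *m (Y m *m f j + C *: (vec1 R n - Y m *m vec1 R n))
    + Bp *m (Y m *m (Y m *m f j + C *: (vec1 R n - Y m *m vec1 R n))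
             + C *: (vec1 R n - Y m *m vec1 R n)))).
    apply: lemxD; first by apply: lemxD; [exact: lemx_refl|exact: lemxMl].
    apply: lemxMl => //; apply: (lemx_trans (IH j.+1)); apply: lemxD.
      by apply: lemxMl.
    exact: lemx_refl.
  have eC : C *: vec1 R n = C *: (Bm *m vec1 R n) + C *: (B0 *m vec1 R n)
      + C *: (Bp *m vec1 R n) by rewrite -!scalerDr -!mulmxDl hB.
  rewrite /= !(mulmxDl, mulmxDr, mulmxBr, scalerDr, scalerBr, mulmxN,
    =^~ scalemxAr, scalerN) !mulmxA eC.
  set S := (X in X <=m _); set T := (X in _ <=m X).
  suff -> : S = T by exact: lemx_refl.
  by rewrite /S /T; mx_abel.
move=> j i k; rewrite ord1.
have cY := @cvgn_mulmx_const _ _ _ _ Y G (f j) natural_iter_cvg i 0.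
have cY1 := @cvgn_mulmx_const _ _ _ _ Y G (vec1 R n) natural_iter_cvg i 0.
have c : (fun m => (Y m *m f j) i 0 + C * (1 - (Y m *m vec1 R n) i 0)) @ \oo
   --> ((G *m f j) i 0 + C * (1 - (G *m vec1 R n) i 0) : R).
  apply: cvgD => //; apply: cvgM; first exact: cvg_cst.
  by apply: cvgB => //; exact: cvg_cst.
have -> : (G *m f j) i 0 = (G *m f j) i 0 + C * (1 - (G *m vec1 R n) i 0).
  by rewrite hG1 [vec1 R n i 0]mxE subrr mulr0 addr0.
rewrite -(cvg_lim _ c) //; apply: limr_ge; first by apply: cvgP c.
apply: nearW => m; have := step m j i 0; rewrite !(entryD, entryZ, entryN).
by rewrite [vec1 R n i 0]mxE.
Qed.

(** Apply the maximum principle to the sequence and to its opposite. *)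
Lemma harmonic_bounded (f : nat -> 'cV[R]_n) (C : R) :
  (forall j i, `|f j i 0| <= C) -> (forall j, harmonic_at Bm B0 Bp f j) ->
  forall j, f j.+1 = G *m f j.
Proof.
move=> hC hf j; apply: lemx_anti.
  apply: (maximum_principle (C := C)) => [l i|l].
    by apply: le_trans (hC l i); exact: ler_norm.
  by rewrite hf; exact: lemx_refl.
rewrite -[G *m f j]opprK -[f j.+1]opprK -mulmxN; apply: lemxN.
apply: (maximum_principle (f := fun j => - f j) (C := C)) => [l i|l].
  by rewrite entryN; apply: le_trans (hC l i); rewrite -normrN; exact: ler_norm.
by rewrite !mulmxN -!opprD hf; exact: lemx_refl.
Qed.

End MinimalSolution.

(** * Chains reflected at the top of a block of levels *)

Lemma inj_unitmx (K : fieldType) n (A : 'M[K]_n) :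
  (forall x : 'cV[K]_n, A *m x = 0 -> x = 0) -> A \in unitmx.
Proof.
move=> h; rewrite -unitmx_tr -row_free_unit; apply: inj_row_free => v hv.
by apply: trmx_inj; rewrite trmx0; apply: h; rewrite -[A]trmxK -trmx_mul hv trmx0.
Qed.

Lemma linear_inj_surj (K : fieldType) m n (f : {linear 'M[K]_(m, n) -> 'M[K]_(m, n)}) :
  (forall u, f u = 0 -> u = 0) -> forall b, exists u, f u = b.
Proof.
move=> h b; have uA : lin_mx f \in unitmx.
  rewrite -row_free_unit; apply: inj_row_free => v hv.
  apply: (can_inj vec_mxK); rewrite linear0; apply: h.
  by apply: (can_inj mxvecK); rewrite -mul_vec_lin vec_mxK hv linear0.
exists (vec_mx (mxvec b *m invmx (lin_mx f))).
by apply: (can_inj mxvecK); rewrite -mul_vec_lin vec_mxK mulmxKV.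
Qed.

Section ReflectedChain.
Variables (R : realType) (n : nat) (Bm B0 Bp X : 'M[R]_n) (N : nat).
Hypothesis hBm : nonneg_mx Bm.
Hypothesis hB0 : nonneg_mx B0.
Hypothesis hBp : nonneg_mx Bp.
Hypothesis hB : (Bm + B0 + Bp) *m vec1 R n = vec1 R n.
Hypothesis hX : stochastic X.

Let average (x : nat -> 'cV[R]_n) l := Bm *m x l + B0 *m x l.+1 + Bp *m x l.+2.

(** Boundary condition of a chain that X sends back from level N+1 to level N.
    *)
Definition reflected (x : nat -> 'cV[R]_n) := x N.+1 = X *m x N.

(** For a chain on the levels 1, ..., N, killed at level 0 and reflected by X
    at the top, absence of a nonzero harmonic function means that every state
    eventually leaves through level 0. *)
Definition no_trap := forall x : nat -> 'cV[R]_n, x 0%N = 0 -> reflected x ->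
  (forall l, (l < N)%N -> harmonic_at Bm B0 Bp x l) ->
  forall l, (l <= N)%N -> x l = 0.

(** The unknown is an n x N matrix whose columns are the levels, on which an
    injective linear map is onto. *)
Lemma reflected_solve : no_trap -> forall b : nat -> 'cV[R]_n, exists x,
  [/\ x 0%N = 0, reflected x &
      forall l, (l < N)%N -> x l.+1 = b l + average x l].
Proof.
move=> inj b.
pose lev (u : 'M[R]_(n, N)) l : 'cV[R]_n :=
  if insub l is Some a then col a u else 0.
pose sq (u : 'M[R]_(n, N)) l : 'cV[R]_n :=
  if l is l'.+1 then (if (l' < N)%N then lev u l' else X *m lev u N.-1) else 0.
have levL l : linear (lev^~ l).
  move=> c u v; rewrite /lev; case: insub => [a|]; last by rewrite scaler0 addr0.
  exact: linearP.
have sqL l : linear (sq^~ l).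
  move=> c u v; rewrite /sq; case: l => [|l]; first by rewrite scaler0 addr0.
  case: ifP => _; first exact: levL.
  by rewrite levL mulmxDr scalemxAr.
pose f (u : 'M[R]_(n, N)) : 'M[R]_(n, N) :=
  \matrix_(i, a) (sq u a.+1 - average (sq u) a) i 0.
have fE u i a : f u i a = (sq u a.+1 - average (sq u) a) i 0 by rewrite mxE.
have fL : linear f.
  move=> c u v; apply/matrixP => i a; rewrite entryD entryZ !fE /average !sqL.
  rewrite !(mulmxDr, =^~ scalemxAr) !(entryD, entryN, entryZ); ring.
pose F : {linear 'M[R]_(n, N) -> 'M[R]_(n, N)} :=
  HB.pack f (GRing.isLinear.Build _ _ _ _ f fL).
have sq_refl u : reflected (sq u).
  rewrite /reflected {1}/sq ltnn; congr (_ *m _).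
  have [N0|N1] := posnP N; first by rewrite N0 /sq /lev insubF // N0.
  rewrite -[in RHS](prednK N1) /sq.
  by case: (ltnP N.-1 N) => //; rewrite leqNgt prednK // leqnn.
have sqE u l i (hl : (l < N)%N) : sq u l.+1 i 0 = u i (Ordinal hl).
  by rewrite /= hl /lev insubT mxE.
have [u uE] : exists u, F u = \matrix_(i, a) b a i 0.
  apply: linear_inj_surj => u /matrixP u0; apply/matrixP => i a; rewrite mxE.
  case: a => l hl; rewrite -sqE.
  rewrite (inj (sq u)) ?mxE // => k hk.
  apply/matrixP => j c; rewrite ord1.
  have := u0 j (Ordinal hk); rewrite (fE u) entryD entryN [in RHS]mxE => /eqP.
  by rewrite subr_eq0 => /eqP.
exists (sq u); split=> // l hl; apply/matrixP => j c; rewrite ord1.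
have := congr1 (fun A => fun_of_matrix A j (Ordinal hl)) uE.
rewrite (fE u) entryD entryN [in RHS]mxE => /eqP; rewrite subr_eq => /eqP -> .
by rewrite [in RHS]entryD.
Qed.

Lemma average_bound (x : nat -> 'cV[R]_n) (m : R) l :
  (forall k i, (l <= k <= l.+2)%N -> m <= x k i 0) ->
  forall i, m <= average x l i 0.
Proof.
move=> h i.
have -> : m = (m *: ((Bm + B0 + Bp) *m vec1 R n)) i 0.
  by rewrite hB !mxE mulr1.
rewrite scalemxAr /average !mulmxDl.
have hm k : (l <= k <= l.+2)%N -> m *: vec1 R n <=m x k.
  by move=> hk a c; rewrite ord1 !mxE mulr1; exact: h.
by apply: lemxD; [apply: lemxD|]; apply: lemxMl => //; apply: hm; lia.
Qed.

Lemma reflected_bound (x : nat -> 'cV[R]_n) (m : R) : reflected x ->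
  (forall i, m <= x N i 0) -> forall i, m <= x N.+1 i 0.
Proof.
have [X0 X1] := hX; move=> -> h i.
have -> : m = (m *: (X *m vec1 R n)) i 0 by rewrite X1 !mxE mulr1.
rewrite scalemxAr; apply: lemxMl => // a c.
by rewrite ord1 !mxE mulr1.
Qed.

(** At a negative minimum the average over the neighbours is at least the
    minimum itself, which leaves no room for the gain e. *)
Lemma reflected_strict_ge0 (x : nat -> 'cV[R]_n) (e : R) : 0 < e ->
  0 <=m x 0%N -> reflected x ->
  (forall l i, (l < N)%N -> e + average x l i 0 <= x l.+1 i 0) ->
  forall l, (l <= N)%N -> 0 <=m x l.
Proof.
move=> e0 x0 xr hx l hl i c; rewrite ord1 mxE {c}.
pose q (p : 'I_N.+1 * 'I_n) := x p.1 p.2 0.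
have [p _ pmin] := @arg_minP _ _ _ (Ordinal (hl : (l < N.+1)%N), i) xpredT q isT.
apply: le_trans (_ : q p <= _); last exact: (pmin (Ordinal (hl : (l < N.+1)%N), i)).
rewrite leNgt; apply/negP => q0.
have low k j : (k <= N)%N -> q p <= x k j 0.
  by move=> hk; apply: (pmin (Ordinal (hk : (k < N.+1)%N), j)).
have low' k j : (k <= N.+1)%N -> q p <= x k j 0.
  rewrite leq_eqVlt => /orP[/eqP ->|]; last exact: low.
  by apply: reflected_bound => // ?; exact: low.
case: p @q pmin q0 low low' => [[k hk] j] /= _ q0 _ low.
case: k hk q0 low => [|k] hk q0 low.
  by move: q0; rewrite ltNge; have := x0 j 0; rewrite mxE => ->.
have := hx k j hk; apply/negP; rewrite -ltNge.
apply: (@lt_le_trans _ _ (e + x k.+1 j 0)); first by rewrite ltrDr.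
by rewrite lerD2l; apply: average_bound => a b hab; apply: low; lia.
Qed.

(** Adding e times the solution of the equation with source 1 makes the
    inequality strict, and e tends to 0. *)
Lemma reflected_ge0 (x : nat -> 'cV[R]_n) : no_trap ->
  0 <=m x 0%N -> reflected x ->
  (forall l, (l < N)%N -> average x l <=m x l.+1) ->
  forall l, (l <= N)%N -> 0 <=m x l.
Proof.
move=> inj x0 xr hx l hl i c; rewrite ord1 mxE {c}.
have [g [g0 gr gE]] := reflected_solve inj (fun=> vec1 R n).
have key e : 0 < e -> 0 <= x l i 0 + e * g l i 0.
  move=> e0; pose x' k := x k + e *: g k.
  have -> : x l i 0 + e * g l i 0 = x' l i 0 by rewrite entryD entryZ.
  have := @reflected_strict_ge0 x' e e0 _ _ _ l hl i 0; rewrite mxE; apply.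
  - by rewrite /x' g0 scaler0 addr0.
  - by rewrite /reflected /x' xr gr mulmxDr scalemxAr.
  - move=> k j hk; have -> : average x' k = average x k + e *: average g k.
      by rewrite /average /x' !mulmxDr !scalerDr !scalemxAr; mx_abel.
    rewrite /x' gE //; have := hx k hk j 0.
    move: (average g k) (average x k) => w v.
    by rewrite !(entryD, entryZ) [vec1 R n j 0]mxE; lra.
rewrite leNgt; apply/negP => xl0.
have := key (- x l i 0 / (2 * (1 + `|g l i 0|))).
have d0 : 0 < 2 * (1 + `|g l i 0|) by have := normr_ge0 (g l i 0); lra.
move=> /(_ _)/wrap[]; first by rewrite divr_gt0 // oppr_gt0.
apply/negP; rewrite -ltNge.
have h1 : - x l i 0 / (2 * (1 + `|g l i 0|)) * g l i 0 <=
          - x l i 0 / (2 * (1 + `|g l i 0|)) * (1 + `|g l i 0|).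
  apply: ler_wpM2l; first by rewrite ltW // divr_gt0 // oppr_gt0.
  by have := ler_norm (g l i 0); lra.
have h2 : - x l i 0 / (2 * (1 + `|g l i 0|)) * (1 + `|g l i 0|) = - x l i 0 / 2.
  by field; apply: lt0r_neq0; have := normr_ge0 (g l i 0); lra.
by lra.
Qed.

(** The zero set of the nonnegative superharmonic th is closed for the chain
    and never reaches level 0, where th is positive. The solution g of the
    equation with source 1 (an expected exit time) would have g >= 1 + min g
    on it. The comparison g >= min g - K th replaces an explicit description
    of the closed set. *)
Lemma no_trap_positive (th : nat -> 'cV[R]_n) (K' : R) : no_trap ->
  (forall l, (l <= N.+1)%N -> 0 <=m th l) ->
  (forall l, (l < N)%N -> average th l <=m th l.+1) ->
  (forall i, 0 < th 0%N i 0) ->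
  X *m th N <=m K' *: th N.+1 ->
  forall l i, (l <= N)%N -> 0 < th l i 0.
Proof.
move=> inj th0 thS thpos thtop l i hl; rewrite lt_neqAle; apply/andP; split; last first.
  by have := th0 l (leqW hl) i 0; rewrite mxE.
apply/negP => /eqP/esym zl.
have [g [g0 gr gE]] := reflected_solve inj (fun=> vec1 R n).
pose q (p : 'I_N.+1 * 'I_n) := g p.1 p.2 0.
pose t (p : 'I_N.+1 * 'I_n) := th p.1 p.2 0.
have := @arg_minP _ _ _ (Ordinal (hl : (l < N.+1)%N), i) (fun p => t p == 0) q.
rewrite /t zl eqxx => /(_ isT)[p /eqP tp pmin].
have t0 p' : 0 <= t p'.
  by have := th0 p'.1 (ltnW (ltn_ord p'.1)) p'.2 0; rewrite mxE.
pose K1 := \sum_p' `|q p - q p'| / t p'.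
have K10 : 0 <= K1 by apply: sumr_ge0 => p' _; rewrite divr_ge0.
have low1 p' : q p - K1 * t p' <= q p'.
  have [tp0|tp0] := eqVneq (t p') 0.
    by rewrite tp0 mulr0 subr0; apply: pmin; apply/eqP.
  have : `|q p - q p'| <= K1 * t p'.
    rewrite -ler_pdivrMr ?lt_neqAle 1?[in X in X && _]eq_sym ?tp0 ?t0 //.
    rewrite /K1 (bigD1 p') //= lerDl; apply: sumr_ge0 => p'' _.
    by rewrite divr_ge0.
  by have := ler_norm (q p - q p'); lra.
pose K2 := K1 * (1 + `|K'|).
have K12 : K1 <= K2 by rewrite /K2 ler_peMr // lerDl.
have low k j : (k <= N.+1)%N -> q p - K2 * th k j 0 <= g k j 0.
  move=> hk; have thk : 0 <= th k j 0 by have := th0 k hk j 0; rewrite mxE.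
  have [hk1|hk1] := leqP k N.
    apply: le_trans (low1 (Ordinal (hk1 : (k < N.+1)%N), j)).
    by rewrite lerD2l lerN2; exact: ler_wpM2r.
  have ek : k = N.+1 by lia.
  rewrite {k hk hk1}ek in thk *.
  have [X0 X1] := hX.
  rewrite gr; apply: (@le_trans _ _ ((X *m (q p *: vec1 R n - K1 *: th N)) j 0)).
    rewrite mulmxBr -!scalemxAr X1 !entryD entryN !entryZ [vec1 R n j 0]mxE mulr1.
    rewrite lerD2l lerN2 /K2 -mulrA; apply: ler_wpM2l => //.
    apply: le_trans (thtop j 0) _; rewrite entryZ; apply: ler_wpM2r => //.
    by apply: le_trans (ler_norm _) _; rewrite lerDr.
  apply: lemxMl => // a c; rewrite ord1 entryD entryN !entryZ [vec1 R n a 0]mxE mulr1.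
  exact: (low1 (ord_max, a)).
have K20 : 0 <= K2 by apply: le_trans K12.
have tp1 : th p.1 p.2 0 = 0 by [].
have [k0|k0] := posnP p.1.
  by move: tp1; rewrite k0 => tp1; have := thpos p.2; rewrite tp1 ltxx.
have kN : (p.1.-1 < N)%N by have := ltn_ord p.1; lia.
have gp : q p = 1 + average g p.1.-1 p.2 0.
  rewrite /q -{1}(prednK k0) gE //; move: (average _ _) => w.
  by rewrite entryD [vec1 R n _ _]mxE.
have thp : average th p.1.-1 p.2 0 <= 0.
  by have := thS p.1.-1 kN p.2 0; rewrite prednK // tp1.
pose x k := g k + K2 *: th k.
have : q p <= average x p.1.-1 p.2 0.
  apply: average_bound => k j hk; rewrite /x entryD entryZ.
  by have := low k j; rewrite lerBlDr; apply; lia.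
have -> : average x p.1.-1 = average g p.1.-1 + K2 *: average th p.1.-1.
  by rewrite /average /x !mulmxDr !scalerDr !scalemxAr; mx_abel.
move: (average g _) (average th _) gp thp => w v gp thp.
rewrite entryD entryZ; have := mulr_ge0_le0 K20 thp; lra.
Qed.

End ReflectedChain.

(** * Invariant rows of X V *)

(** Reading the levels backwards exchanges the blocks Bm and Bp. *)
Lemma harmonic_flip (R : fieldType) n m (Bm B0 Bp : 'M[R]_n)
    (x : nat -> 'M[R]_(n, m)) N l : (l < N)%N ->
  harmonic_at Bp B0 Bm x (N - l.+1) ->
  harmonic_at Bm B0 Bp (fun k => x (N.+1 - k)%N) l.
Proof.
move=> hl; rewrite /harmonic_at.
have -> : (N.+1 - l = (N - l.+1).+2)%N by lia.
have -> : (N.+1 - l.+1 = (N - l.+1).+1)%N by lia.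
have -> : (N.+1 - l.+2 = (N - l.+1))%N by lia.
by move=> /= h; rewrite -[in RHS]h; mx_abel.
Qed.

Lemma harmonic_mulr (R : fieldType) n m p (Bm B0 Bp : 'M[R]_n)
    (x : nat -> 'M[R]_(n, m)) (w : 'M[R]_(m, p)) l :
  harmonic_at Bm B0 Bp x l -> harmonic_at Bm B0 Bp (fun k => x k *m w) l.
Proof. by rewrite /harmonic_at !mulmxA -!mulmxDl => ->. Qed.

Lemma harmonicD (R : fieldType) n m (Bm B0 Bp : 'M[R]_n)
    (x y : nat -> 'M[R]_(n, m)) l :
  harmonic_at Bm B0 Bp x l -> harmonic_at Bm B0 Bp y l ->
  harmonic_at Bm B0 Bp (fun k => x k + y k) l.
Proof.
rewrite /harmonic_at /= => hx hy.
by rewrite -[in RHS]hx -[in RHS]hy !mulmxDr; mx_abel.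
Qed.

Lemma harmonicN (R : fieldType) n m (Bm B0 Bp : 'M[R]_n)
    (x : nat -> 'M[R]_(n, m)) l :
  harmonic_at Bm B0 Bp x l -> harmonic_at Bm B0 Bp (fun k => - x k) l.
Proof. by rewrite /harmonic_at /= => hx; rewrite -[in RHS]hx !mulmxN; mx_abel. Qed.

Definition support_ind (R : realType) n (y : 'rV[R]_n) : 'cV[R]_n :=
  \col_i (y 0 i != 0)%:R.

Definition abs_mx (R : realType) m n (y : 'M[R]_(m, n)) := map_mx Num.norm y.

Lemma abs_mx_nonneg (R : realType) m n (y : 'M[R]_(m, n)) : nonneg_mx (abs_mx y).
Proof. by apply/nonneg_mxP => i j; rewrite mxE. Qed.

(** The inequality |y| <= |y| W holds entrywise, and the total mass of the
    right-hand side is not larger, so it is an equality. *)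
Lemma abs_invariant (R : realType) n (W : 'M[R]_n) (y : 'rV[R]_n) :
  nonneg_mx W -> W *m vec1 R n <=m vec1 R n -> y *m W = y ->
  abs_mx y *m W = abs_mx y.
Proof.
move=> /nonneg_mxP W0 W1 yW.
have le j : abs_mx y 0 j <= (abs_mx y *m W) 0 j.
  rewrite mxE -{1}yW !mxE; apply: le_trans (ler_norm_sum _ _ _) _.
  by apply: ler_sum => i _; rewrite mxE normrM (ger0_norm (W0 _ _)).
have tot : \sum_j (abs_mx y *m W) 0 j <= \sum_j abs_mx y 0 j.
  under eq_bigr do rewrite mxE; rewrite exchange_big /=; apply: ler_sum => i _.
  rewrite -mulr_sumr -row_sumE -[leRHS]mulr1; apply: ler_wpM2l; first by rewrite mxE.
  by have := W1 i 0; rewrite [vec1 _ _ _ _]mxE.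
have eq0 : \sum_j ((abs_mx y *m W) 0 j - abs_mx y 0 j) = 0.
  apply/le_anti/andP; split; first by rewrite sumrB subr_le0.
  by apply: sumr_ge0 => j _; rewrite subr_ge0.
apply/matrixP => a j; rewrite ord1; apply/eqP; rewrite -subr_eq0; apply/eqP.
apply/eqP; move/eqP: eq0; rewrite psumr_eq0 => [/allP/(_ j)|i _].
  by rewrite mem_index_enum => /(_ isT).
by rewrite subr_ge0.
Qed.

Lemma nonneg_dot0 (R : realType) n (y : 'rV[R]_n) (x : 'cV[R]_n) :
  nonneg_mx y -> 0 <=m x -> (y *m x) 0 0 = 0 ->
  forall i, y 0 i != 0 -> x i 0 = 0.
Proof.
move=> /nonneg_mxP y0 x0; rewrite mxE => /eqP.
rewrite psumr_eq0 => [/allP h i yi|i _]; last first.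
  by rewrite mulr_ge0 //; have := x0 i 0; rewrite mxE.
have := h i; rewrite mem_index_enum => /(_ isT) /=.
by rewrite mulf_eq0 (negbTE yi) => /eqP.
Qed.

Section Trap.
Variables (R : realType) (n : nat) (Bm B0 Bp X V : 'M[R]_n).
Hypothesis hBm : nonneg_mx Bm.
Hypothesis hB0 : nonneg_mx B0.
Hypothesis hBp : nonneg_mx Bp.
Hypothesis hB : (Bm + B0 + Bp) *m vec1 R n = vec1 R n.
Hypothesis hX : stochastic X.
Hypothesis hV0 : nonneg_mx V.
Hypothesis hV1 : V *m vec1 R n <=m vec1 R n.
Hypothesis eV : qbd_solution Bp B0 Bm V.

Lemma harmonic_vec1 l : harmonic_at Bm B0 Bp (fun=> vec1 R n) l.
Proof. by rewrite /harmonic_at -!mulmxDl. Qed.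

Lemma harmonic_V m (w : 'M[R]_(n, m)) N l : (l < N)%N ->
  harmonic_at Bm B0 Bp (fun k => V ^+ (N.+1 - k) *m w) l.
Proof.
move=> hl; apply: harmonic_mulr; apply: (harmonic_flip (x := fun k => V ^+ k)) => //.
exact: harmonic_expr.
Qed.

Lemma expr_support_le (y : 'rV[R]_n) m : V ^+ m *m support_ind y <=m vec1 R n.
Proof.
apply: lemx_trans (expr_sub_vec1 m hV0 hV1); apply: lemxMl.
  exact: nonneg_mxX.
by move=> i j; rewrite !mxE; case: eqP => _; rewrite ?ler01 ?lexx.
Qed.

(** An invariant row y of X V describes states from which the chain goes up
    one level surely and is sent back by X to the support of y X. With Y the
    support of y, the function th equal to 1 - V^m 1_Y + psi_m at level N+1-m
    is harmonic and vanishes on these states at the top level; without a trap,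
    th cannot be positive everywhere at level 0. *)
Lemma trap (y : 'rV[R]_n) (psi : nat -> 'cV[R]_n) N :
  no_trap Bm B0 Bp X N -> nonneg_mx y -> y != 0 -> y *m X *m V = y ->
  (forall m, harmonic_at Bp B0 Bm psi m) -> (forall m, 0 <=m psi m) ->
  psi 0%N = 0 -> y *m X *m psi 1%N = 0 ->
  exists i, 1 - (V ^+ N.+1 *m support_ind y) i 0 + psi N.+1 i 0 <= 0.
Proof.
move=> inj y0 yn0 yXV psih psi0 psiz psi1.
have [X0 X1] := hX.
apply: contrapT => hno.
pose th l := vec1 R n - V ^+ (N.+1 - l) *m support_ind y + psi (N.+1 - l)%N.
have thpos l : 0 <=m th l.
  move=> i j; have := expr_support_le y (N.+1 - l) i j; have := psi0 (N.+1 - l)%N i j.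
  rewrite /th !entryD entryN ![(0 : 'cV_n) i j]mxE; lra.
have thN : (y *m X *m th N) 0 0 = 0.
  rewrite /th subSnn expr1 mulmxDr psi1 addr0 mulmxBr mulmxA yXV -mulmxA X1.
  rewrite entryD entryN !mxE -sumrB big1 // => i _; rewrite !mxE.
  by case: eqP => [->|_]; rewrite ?mul0r ?subrr.
have top : X *m th N <=m (\sum_i (X *m th N) i 0) *: th N.+1.
  have Xth : 0 <=m X *m th N.
    by rewrite -[0 : 'cV_n](mulmx0 _ X); apply: lemxMl.
  have Xth0 i : 0 <= (X *m th N) i 0 by have := Xth i 0; rewrite mxE.
  move=> i j; rewrite ord1 entryZ /th subnn expr0 mul1mx psiz addr0 entryD entryN.
  rewrite [vec1 R n i 0]mxE [support_ind y i 0]mxE.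
  have [yi|yi] := eqVneq (y 0 i) 0.
    rewrite subr0 mulr1 (bigD1 i) //= lerDl; apply: sumr_ge0 => *; exact: Xth0.
  rewrite subrr mulr0.
  by rewrite (nonneg_dot0 y0 Xth _ yi) // mulmxA.
have pos := no_trap_positive hBm hB0 hBp hB hX inj (fun l _ => thpos l) _ _ top.
have z0 : nonneg_mx (y *m X) by exact: nonneg_mxM.
have [zi|] := pselect (exists i, (y *m X) 0 i != 0); last first.
  move=> hz; move/negP: yn0; apply; apply/eqP; rewrite -yXV.
  suff -> : y *m X = 0 by rewrite mul0mx.
  apply/matrixP => a i; rewrite ord1 [RHS]mxE; apply/eqP; apply: contrapT => h.
  by apply: hz; exists i; apply/negP.
case: zi => i zi; have := nonneg_dot0 z0 (thpos N) thN zi.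
apply/eqP/lt0r_neq0; apply: pos => [l hl|j|]; last exact: leqnn.
  have e : Bm *m th l + B0 *m th l.+1 + Bp *m th l.+2 = th l.+1.
    exact: (harmonicD (harmonicD (harmonic_vec1 l)
      (harmonicN (harmonic_V (support_ind y) hl))) (harmonic_flip hl (psih _))).
  by rewrite [X in X <=m _]e; exact: lemx_refl.
rewrite ltNge; apply/negP => h; apply: hno; exists j.
by move: h; rewrite /th subn0 !entryD entryN [vec1 R n j 0]mxE.
Qed.

Hypothesis often_no_trap : forall N0, exists2 N, (N0 <= N)%N & no_trap Bm B0 Bp X N.

Lemma XV_sub : X *m V *m vec1 R n <=m vec1 R n.
Proof.
have [X0 X1] := hX; rewrite -mulmxA -[in X in _ <=m X]X1.
exact: lemxMl.
Qed.

(** Here V^m 1_Y is small m levels down, so that [trap] applied to |y| rules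
    out every invariant row. *)
Lemma unit_of_transient :
  (forall i j, (fun m => (V ^+ m) i j) @ \oo --> (0 : R)) ->
  1%:M - X *m V \in unitmx.
Proof.
have [X0 X1] := hX.
move=> V_cvg; rewrite -row_free_unit; apply: inj_row_free => y.
rewrite mulmxBr mulmx1 mulmxA => /eqP; rewrite subr_eq0 => /eqP/esym yXV.
apply: contrapT => /eqP yn0.
have ya : abs_mx y *m X *m V = abs_mx y.
  rewrite -mulmxA; apply: abs_invariant; last by rewrite mulmxA.
    exact: nonneg_mxM.
  exact: XV_sub.
have an0 : abs_mx y != 0.
  apply/negP => /eqP h; move/negP: yn0; apply; apply/eqP/matrixP => i j.
  by have := congr1 (fun A => fun_of_matrix A i j) h; rewrite !mxE => /normr0_eq0.
have small : \forall m \near \oo, forall i, (V ^+ m *m support_ind (abs_mx y)) i 0 < 1.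
  apply: filter_forall => i.
  have c : (fun m => (V ^+ m *m support_ind (abs_mx y)) i 0) @ \oo --> (0 : R).
    have := @cvgn_mulmx_const R _ _ _ (fun m => V ^+ m) 0 (support_ind (abs_mx y)) _ i 0.
    rewrite mul0mx [X in _ --> X]mxE; apply => a b.
    by rewrite [X in _ --> X]mxE; exact: V_cvg.
  exact: (cvgr_lt _ c _ ltr01).
case: small => N0 _ small; have [N N0N ntN] := often_no_trap N0.
have [||||i] := @trap (abs_mx y) (fun=> 0) N ntN (abs_mx_nonneg y) an0 ya.
- by move=> m; rewrite /harmonic_at !mulmx0 !addr0.
- by move=> m; exact: lemx_refl.
- by [].
- by rewrite mulmx0.
by have := small N.+1 (leqW N0N) i; rewrite [(0 : 'cV_n) i 0]mxE; lra.
Qed.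

Hypothesis V1 : V *m vec1 R n = vec1 R n.
Hypothesis V_rows : forall i i' j,
  (fun m => (V ^+ m) i j - (V ^+ m) i' j) @ \oo --> (0 : R).
Hypothesis minV : minimal_nonneg_solution (qbd_solution Bp B0 Bm) V.
Variable u : 'cV[R]_n.
Hypothesis poisson : (Bm + B0 + Bp) *m u + Bp *m vec1 R n = u + Bm *m vec1 R n.

(** Difference of two harmonic sequences read downwards: the values u - m 1
    and their conditional expectation V^m u at the next passages upwards. *)
Lemma drift_harmonic m :
  harmonic_at Bp B0 Bm (fun m => V ^+ m *m u - u + m%:R *: vec1 R n) m.
Proof.
rewrite /harmonic_at.
have h : Bp *m (V ^+ m *m u) + B0 *m (V ^+ m.+1 *m u) + Bm *m (V ^+ m.+2 *m u) =
         V ^+ m.+1 *m u.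
  by apply: (@harmonic_mulr _ _ _ _ Bp B0 Bm (fun m => V ^+ m)); exact: harmonic_expr.
rewrite -[in RHS]h.
have e1 : Bm *m vec1 R n = (Bm + B0 + Bp) *m u + Bp *m vec1 R n - u.
  by rewrite poisson; mx_abel.
have e2 : B0 *m vec1 R n = vec1 R n - Bm *m vec1 R n - Bp *m vec1 R n.
  by rewrite -[in X in _ = X - _ - _]hB !mulmxDl; mx_abel.
rewrite !mulmxDr !mulmxN -!scalemxAr e2 e1 !mulmxDl -!natr1.
by mx_abel.
Qed.

Let psi m := V ^+ m *m u - u + m%:R *: vec1 R n.
Let cu := \sum_i `|u i 0|.

Lemma cu_bound i : `|u i 0| <= cu.
Proof. by rewrite /cu (bigD1 i) //= lerDl; apply: sumr_ge0. Qed.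

Lemma cu_ge0 : 0 <= cu.
Proof. by apply: sumr_ge0. Qed.

Lemma drift_lower m i : m%:R - 2 * cu <= psi m i 0.
Proof.
rewrite /psi entryD entryD entryN entryZ [vec1 R n i 0]mxE mulr1.
have h1 : u i 0 <= cu by apply: le_trans (cu_bound i); exact: ler_norm.
have h2 : (V ^+ m *m (- u)) i 0 <= cu.
  apply: mul_sto_bound; first exact: nonneg_mxX.
    exact: expr_vec1.
  move=> j; rewrite entryN; apply: le_trans (cu_bound j).
  by rewrite -normrN; exact: ler_norm.
move: h2; rewrite mulmxN entryN; lra.
Qed.

(** Its opposite is bounded above and vanishes at the top, so the maximum
    principle for V applies. *)
Lemma drift_ge0 m : 0 <=m psi m.
Proof.
suff h : - psi m <=m 0 by rewrite -[psi m]opprK -oppr0; exact: lemxN.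
have hB' : (Bp + B0 + Bm) *m vec1 R n = vec1 R n.
  by rewrite -[RHS]hB !mulmxDl; mx_abel.
elim: m => [|m IH].
  rewrite /psi expr0 mul1mx subrr scale0r addr0 oppr0; exact: lemx_refl.
have mp := @maximum_principle R n Bp B0 Bm V hBp hB0 hBm hB' minV V1 (fun m => - psi m) (2 * cu).
apply: lemx_trans (mp _ _ m) _.
- move=> j i; rewrite entryN; have := drift_lower j i; have := ler0n R j; lra.
- move=> j; rewrite !mulmxN -!opprD [X in _ <=m - X]drift_harmonic; exact: lemx_refl.
- by rewrite -[X in _ <=m X](mulmx0 _ V); exact: lemxMl.
Qed.

(** Let y be orthogonal to the columns; its positive and negative parts are
    both invariant. If both are nonzero, [trap] finds rows of V^m concentrated
    on two disjoint supports, whereas all the rows of V^m become equal. If y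
    has a constant sign, [trap] applies with psi the drift sequence, whose
    positivity deep below contradicts its conclusion. *)
Lemma recurrent_row_free :
  row_free (row_mx (1%:M - X *m V) (vec1 R n + u - X *m u)).
Proof.
have [X0 X1] := hX.
apply: inj_row_free => y; rewrite mul_mx_row => /eqP; rewrite row_mx_eq0.
rewrite mulmxBr mulmx1 mulmxA subr_eq0 => /andP[/eqP/esym yXV /eqP yv].
have ya : abs_mx y *m X *m V = abs_mx y.
  rewrite -mulmxA; apply: abs_invariant; last by rewrite mulmxA.
    exact: nonneg_mxM.
  exact: XV_sub.
pose yp := abs_mx y + y; pose yn := abs_mx y - y.
have ypXV : yp *m X *m V = yp by rewrite !mulmxDl ya yXV.
have ynXV : yn *m X *m V = yn by rewrite !mulmxBl ya yXV.
have yp0 : nonneg_mx yp.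
  by apply/nonneg_mxP => i j; rewrite !mxE; have := ler_norm (- y i j); rewrite normrN; lra.
have yn0 : nonneg_mx yn.
  by apply/nonneg_mxP => i j; rewrite !mxE; have := ler_norm (y i j); lra.
(* deep below the top the drift sequence is positive, against [trap] *)
have one_sign (w : 'rV[R]_n) : nonneg_mx w -> w *m X *m V = w ->
    w *m (vec1 R n + u - X *m u) = 0 -> w = 0.
  move=> w0 wXV wv; apply: contrapT => /eqP wn0.
  have [N hN ntN] := often_no_trap (Num.bound (2 * cu)).
  have [||||i] := @trap w psi N ntN w0 wn0 wXV.
  - exact: drift_harmonic.
  - exact: drift_ge0.
  - by rewrite /psi expr0 mul1mx subrr scale0r addr0.
  - rewrite -wv /psi expr1 scale1r !mulmxDr !mulmxN !mulmxA wXV -mulmxA X1.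
    by mx_abel.
  have h1 := drift_lower N.+1 i.
  have h2 := expr_support_le w N.+1 i 0.
  have h3 : 2 * cu < N.+1%:R.
    apply: lt_le_trans (archi_boundP _) _; first by rewrite mulr_ge0 // cu_ge0.
    by rewrite ler_nat; exact: leqW.
  by move: h2; rewrite [vec1 R n i 0]mxE; lra.
have yE : y = 2^-1 *: (yp - yn).
  by apply/matrixP => i j; rewrite /yp /yn !mxE; field.
have [yp_eq|ypn] := eqVneq yp 0.
  have -> : y = 0; last by [].
  rewrite yE yp_eq sub0r (one_sign yn) ?oppr0 ?scaler0 //.
  have -> : yn = - (2%:R *: y) by rewrite yE yp_eq scalerA divff // scale1r sub0r opprK.
  by rewrite mulNmx -scalemxAl yv scaler0 oppr0.
have [yn_eq|ynn] := eqVneq yn 0.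
  have -> : y = 0; last by [].
  rewrite yE yn_eq subr0 (one_sign yp) ?scaler0 //.
  have -> : yp = 2%:R *: y by rewrite yE yn_eq scalerA divff // scale1r subr0.
  by rewrite -scalemxAl yv scaler0.
exfalso.
have close : \forall m \near \oo, forall i i' : 'I_n,
    (V ^+ m *m support_ind yp) i 0 - (V ^+ m *m support_ind yp) i' 0 < 1.
  apply: filter_forall => i; apply: filter_forall => i'.
  have c : (fun m => (V ^+ m *m support_ind yp) i 0 - (V ^+ m *m support_ind yp) i' 0) @ \oo --> (0 : R).
    have e0 : \sum_(j < n) 0 * support_ind yp j 0 = 0.
      by rewrite big1 // => j _; rewrite mul0r.
    have c' : (fun m => \sum_(j < n) ((V ^+ m) i j - (V ^+ m) i' j) *
        support_ind yp j 0) @ \oo --> (\sum_(j < n) 0 * support_ind yp j 0 : R).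
      apply: cvgn_sum => j.
      exact: (cvgM (V_rows i i' j) (cvg_cst (support_ind yp j 0))).
    rewrite e0 in c'; move: c'.
    have -> : (fun m => \sum_(j < n) ((V ^+ m) i j - (V ^+ m) i' j) *
        support_ind yp j 0) = (fun m => (V ^+ m *m support_ind yp) i 0
      - (V ^+ m *m support_ind yp) i' 0); last by [].
    by apply/funext => m; rewrite !mxE -sumrB; apply: eq_bigr => j _; rewrite mulrBl.
  exact: (cvgr_lt _ c _ ltr01).
case: close => N0 _ close; have [N N0N ntN] := often_no_trap N0.
have psi0 m : harmonic_at Bp B0 Bm (fun=> 0 : 'cV[R]_n) m.
  by rewrite /harmonic_at !mulmx0 !addr0.
have [||i] := trap ntN yp0 ypn ypXV psi0 (fun=> @lemx_refl _ _ _ _).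
  by [].
  by rewrite mulmx0.
have [||i'] := trap ntN yn0 ynn ynXV psi0 (fun=> @lemx_refl _ _ _ _).
  by [].
  by rewrite mulmx0.
rewrite [(0 : 'cV_n) i' 0]mxE [(0 : 'cV_n) i 0]mxE => h' h.
have le1 : support_ind yp <=m vec1 R n - support_ind yn.
  move=> j c; rewrite entryD entryN !mxE.
  by case: (ler0P (y 0 j)) => hy; do 2?case: eqP => ? /=; lra.
have := lemxMl (nonneg_mxX N.+1 hV0) le1 i' 0.
rewrite mulmxBr expr_vec1 // entryD entryN [vec1 R n i' 0]mxE.
by have := close N.+1 (leqW N0N) i i'; lra.
Qed.

End Trap.

(** * The Poisson equation and the drift *)

(** At a maximal entry of w the average A w cannot exceed w, and at a minimal
    entry it cannot be smaller. *)
Lemma stochastic_shift (R : realType) n (A : 'M[R]_n) (w : 'cV[R]_n) (a : R) (i0 : 'I_n) :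
  stochastic A -> A *m w = w + a *: vec1 R n -> a = 0.
Proof.
move=> [A0 A1] eA.
have half (v : 'cV[R]_n) b : A *m v = v + b *: vec1 R n -> b <= 0.
  move=> ev; have [i _ imax] := @arg_maxP _ _ _ i0 xpredT (fun i => v i 0) isT.
  have := mul_sto_bound A0 A1 (fun j => imax j isT) i.
  rewrite ev entryD entryZ [vec1 R n i 0]mxE; lra.
apply/le_anti/andP; split; first exact: half eA.
rewrite -oppr_le0; apply: (half (- w)).
by rewrite mulmxN eA opprD scaleNr.
Qed.

(** I - B has corank one and 1 is not in its range, so u with u_(i0) = 0 and s
    are the coordinates of d in an invertible system. *)
Lemma poisson_solvable (R : realType) n (B : 'M[R]_n) (d : 'cV[R]_n) (i0 : 'I_n) :
  stochastic B ->
  (forall x : 'cV[R]_n, B *m x = x -> exists a, x = a *: vec1 R n) ->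
  exists u s, B *m u + d = u + s *: vec1 R n.
Proof.
move=> sB ker.
pose w (x : 'cV[R]_n) : 'cV[R]_n := x - x i0 0 *: delta_mx i0 0.
pose M := (1%:M - B) *m (1%:M - delta_mx i0 i0) + vec1 R n *m delta_mx 0 i0.
have dx m (x : 'cV[R]_n) (k : 'I_m) : delta_mx k i0 *m x = x i0 0 *: delta_mx k 0.
  apply/matrixP => i j; rewrite ord1 !mxE (bigD1 i0) //= big1 => [|l li0].
    by rewrite !mxE !eqxx andbT addr0 mulrC.
  by rewrite !mxE (negbTE li0) andbF mul0r.
have ME x : M *m x = w x - B *m w x + x i0 0 *: vec1 R n.
  have e1 : (1%:M - delta_mx i0 i0) *m x = w x by rewrite mulmxBl mul1mx dx.
  rewrite mulmxDl -!mulmxA e1 mulmxBl mul1mx dx.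
  congr (_ + _); rewrite -scalemxAr; congr (_ *: _).
  by apply/matrixP => i j; rewrite !ord1 !mxE big_ord1 !mxE mulr1.
have uM : M \in unitmx.
  apply: inj_unitmx => x; rewrite ME => h.
  have e : B *m w x = w x + x i0 0 *: vec1 R n.
    by rewrite -[RHS]subr0 -h; mx_abel.
  have x0 := stochastic_shift i0 sB e.
  move: e; rewrite x0 scale0r addr0 => /ker [a wa].
  have : w x i0 0 = a by rewrite wa !mxE mulr1.
  rewrite /w x0 scale0r subr0 x0 => a0.
  by move: wa; rewrite /w x0 -a0 !scale0r subr0.
exists (w (invmx M *m d)), ((invmx M *m d) i0 0).
have := ME (invmx M *m d); rewrite mulKVmx // => {2}->.
by mx_abel.
Qed.

Section Drift.
Variables (R : realType) (n : nat) (Bm B0 Bp G : 'M[R]_n) (i0 : 'I_n).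
Hypothesis hBm : nonneg_mx Bm.
Hypothesis hB0 : nonneg_mx B0.
Hypothesis hBp : nonneg_mx Bp.
Hypothesis hB : (Bm + B0 + Bp) *m vec1 R n = vec1 R n.
Hypothesis minG : minimal_nonneg_solution (qbd_solution Bm B0 Bp) G.
Hypothesis hG1 : G *m vec1 R n = vec1 R n.

(** The inverse function exceeds its tangent at X by a second order term,
    which the gain s absorbs. *)
Lemma inverse_tangent (s X Y : R) : 0 < X -> 0 < Y -> (Y - X) ^+ 2 <= s * Y ->
  Y^-1 <= X^-1 - (Y - X) / X ^+ 2 + s / X ^+ 2.
Proof.
move=> X0 Y0 h.
have -> : X^-1 - (Y - X) / X ^+ 2 + s / X ^+ 2 = (X - (Y - X) + s) / X ^+ 2.
  by field; apply: lt0r_neq0.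
rewrite ler_pdivlMr ?exprn_gt0 // mulrC ler_pdivrMr //.
by nra.
Qed.

(** If s were positive, -1/(u + j + L) would be subharmonic for L large,
    because the gain s beats the bounded increments; it is bounded above by 0
    and tends to 0 as j grows, while the maximum principle keeps it below its
    negative maximum at level 0. *)
Lemma recurrent_drift (u : 'cV[R]_n) (s : R) :
  (Bm + B0 + Bp) *m u + (Bp *m vec1 R n - Bm *m vec1 R n) = u + s *: vec1 R n ->
  s <= 0.
Proof.
move=> pois; rewrite leNgt; apply/negP => s0.
pose c := \sum_i `|u i 0|.
have uc i : `|u i 0| <= c by rewrite /c (bigD1 i) //= lerDl; apply: sumr_ge0.
have c0 : 0 <= c by apply: sumr_ge0.
pose b := 2 * c + 1.
pose L := c + 1 + b ^+ 2 / s.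
have bs0 : 0 <= b ^+ 2 / s by rewrite divr_ge0 ?sqr_ge0 // ltW.
pose x j : 'cV[R]_n := u + (j%:R + L) *: vec1 R n.
have xE j i : x j i 0 = u i 0 + j%:R + L.
  by rewrite entryD entryZ [vec1 R n i 0]mxE mulr1 addrA.
have xlow j i : 1 + b ^+ 2 / s <= x j i 0.
  rewrite xE /L; have := ler_norm (- u i 0); rewrite normrN.
  by have := uc i; have := ler0n R j; lra.
have xpos j i : 0 < x j i 0 by have := xlow j i; lra.
have near j j' i k : `|j%:R - j'%:R : R| <= 1 -> (x j i 0 - x j' k 0) ^+ 2 <= s * x j i 0.
  move=> jj; apply: (@le_trans _ _ (b ^+ 2)); last first.
    have := xlow j i; rewrite -ler_pdivrMl // mulrC; lra.
  have h1 : `|x j i 0 - x j' k 0| <= b.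
    rewrite !xE /b; have h2 := uc i; have h3 := uc k; move: jj.
    rewrite ler_norml => /andP[jj1 jj2]; rewrite ler_norml.
    move: h2 h3; rewrite !ler_norml => /andP[? ?] /andP[? ?]; apply/andP; split; lra.
  by rewrite -real_normK ?num_real // ler_pXn2r // nnegrE // /b; lra.
pose g j : 'cV[R]_n := \col_i - (x j i 0)^-1.
have gS : subharmonic Bm B0 Bp g.
  move=> j i k; rewrite ord1 {k}.
  pose X := x j.+1 i 0.
  pose lin j' : 'cV[R]_n := (- X^-1 - X / X ^+ 2 - s / X ^+ 2) *: vec1 R n + (X ^+ 2)^-1 *: x j'.
  have X0 : 0 < X := xpos j.+1 i.
  have tang j' : `|j'%:R - j.+1%:R : R| <= 1 -> lin j' <=m g j'.
    move=> jj k l; rewrite ord1 /lin entryD !entryZ [vec1 R n k 0]mxE mulr1 [g _ _ _]mxE.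
    have := inverse_tangent X0 (xpos j' k) (near j' j.+1 k i jj).
    rewrite -/X => h; rewrite -[leLHS]opprK lerN2; apply: le_trans h _.
    by rewrite le_eqVlt; apply/orP; left; apply/eqP; ring.
  have h : Bm *m lin j + B0 *m lin j.+1 + Bp *m lin j.+2 <=m
           Bm *m g j + B0 *m g j.+1 + Bp *m g j.+2.
    by apply: lemxD; [apply: lemxD|]; apply: lemxMl => //; apply: tang;
      rewrite -?natr1 ler_norml; apply/andP; split; lra.
  apply: le_trans (h i 0).
  have -> : Bm *m lin j + B0 *m lin j.+1 + Bp *m lin j.+2 =
    (- X^-1 - X / X ^+ 2 - s / X ^+ 2) *: vec1 R n + (X ^+ 2)^-1 *: (x j.+1 + s *: vec1 R n).
    rewrite -{1}hB /lin !mulmxDr -!scalemxAr.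
    have -> : x j.+1 + s *: vec1 R n = Bm *m x j + B0 *m x j.+1 + Bp *m x j.+2.
      have -> : x j.+1 + s *: vec1 R n =
        u + s *: vec1 R n + (j.+1%:R + L) *: ((Bm + B0 + Bp) *m vec1 R n).
        by rewrite hB /x; mx_abel.
      rewrite -pois /x !mulmxDr -!scalemxAr !mulmxDl -!natr1; mx_abel.
    by rewrite !mulmxDl !scalerDr; mx_abel.
  have ex : x j.+1 i 0 = X by [].
  rewrite [leLHS]mxE ex; move: (x j.+1) ex => v ev.
  rewrite !(entryD, entryZ) ev [vec1 R n i 0]mxE.
  by rewrite le_eqVlt; apply/orP; left; apply/eqP; field; apply: lt0r_neq0.
have glow j i : g j i 0 <= - (c + L)^-1.
  have mp := maximum_principle hBm hB0 hBp hB minG hG1 (C := 0) _ gS.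
  have gneg j' i' : g j' i' 0 <= 0 by rewrite mxE oppr_le0 invr_ge0 ltW.
  have G0 : nonneg_mx G by case: minG.
  elim: j i => [|j IH] i.
    rewrite mxE lerN2 lef_pV2 ?posrE //; last by have := xpos 0%N i; rewrite xE; 
      have := ler_norm (u i 0); have := uc i; lra.
    by rewrite xE addr0 lerD2r; apply: le_trans (ler_norm _) _.
  apply: le_trans (mp gneg j i 0) _; exact: mul_sto_bound.
have := glow (Num.bound (2 * c)) i0.
have := archi_boundP (_ : 0 <= 2 * c); rewrite mulr_ge0 // => /(_ isT) hc.
have cL : 0 < c + L by rewrite /L; lra.
rewrite mxE lerN2 lef_pV2 ?posrE // xE.
have := ler_norm (- u i0 0); rewrite normrN; have := uc i0; lra.
Qed.

End Drift.

(** Recurrence downwards gives s <= 0, and recurrence upwards, with the blocks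
    exchanged, gives -s <= 0. *)
Lemma null_recurrent_poisson (R : realType) n (Bm B0 Bp G V : 'M[R]_n) (i0 : 'I_n) :
  nonneg_mx Bm -> nonneg_mx B0 -> nonneg_mx Bp ->
  (Bm + B0 + Bp) *m vec1 R n = vec1 R n ->
  minimal_nonneg_solution (qbd_solution Bm B0 Bp) G ->
  minimal_nonneg_solution (qbd_solution Bp B0 Bm) V ->
  G *m vec1 R n = vec1 R n -> V *m vec1 R n = vec1 R n ->
  (forall x : 'cV[R]_n, (Bm + B0 + Bp) *m x = x -> exists a, x = a *: vec1 R n) ->
  exists u : 'cV[R]_n,
    (Bm + B0 + Bp) *m u + Bp *m vec1 R n = u + Bm *m vec1 R n.
Proof.
move=> hBm hB0 hBp hB minG minV G1 V1 ker.
have sB : stochastic (Bm + B0 + Bp) by split=> //; do !apply: nonneg_mxD.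
have [u [s pois]] := poisson_solvable (Bp *m vec1 R n - Bm *m vec1 R n) i0 sB ker.
have s_le := recurrent_drift i0 hBm hB0 hBp hB minG G1 pois.
have hB' : Bp + B0 + Bm = Bm + B0 + Bp by mx_abel.
have s_ge : - s <= 0.
  apply: (recurrent_drift i0 hBp hB0 hBm _ minV V1 (u := - u)).
    by rewrite hB'.
  have -> : - u + - s *: vec1 R n = - (u + s *: vec1 R n) by mx_abel.
  by rewrite -pois hB' mulmxN; mx_abel.
have s0 : s = 0 by lra.
exists u; move: pois; rewrite s0 scale0r addr0 => h.
by rewrite -[in RHS]h; mx_abel.
Qed.

(** * Growth of matrix powers *)

Section ComplexModulus.
Variable R : realType.
Implicit Types z w : R[i].

Lemma cmodC z : (cmod z)%:C%C = `|z|.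
Proof. by rewrite /cmod normc_def. Qed.

Lemma cmod_ge0 z : 0 <= cmod z.
Proof. by rewrite -lecR cmodC normr_ge0. Qed.

Lemma cmodD z w : cmod (z + w) <= cmod z + cmod w.
Proof. by rewrite -lecR rmorphD !cmodC ler_normD. Qed.

Lemma cmodM z w : cmod (z * w) = cmod z * cmod w.
Proof. by apply: complexI; rewrite rmorphM !cmodC normrM. Qed.

Lemma cmodX z k : cmod (z ^+ k) = cmod z ^+ k.
Proof. by apply: complexI; rewrite rmorphXn !cmodC normrX. Qed.

Lemma cmodV z : cmod z^-1 = (cmod z)^-1.
Proof. by apply: complexI; rewrite fmorphV !cmodC normfV. Qed.

Lemma cmodN z : cmod (- z) = cmod z.
Proof. by apply: complexI; rewrite !cmodC normrN. Qed.

Lemma cmod_real (x : R) : cmod x%:C%C = `|x|.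
Proof. by apply: complexI; rewrite cmodC normc_def /= expr0n addr0 sqrtr_sqr. Qed.

Lemma cmod0 : cmod (0 : R[i]) = 0.
Proof. by apply: complexI; rewrite cmodC normr0. Qed.

Lemma cmod1 : cmod (1 : R[i]) = 1.
Proof. by apply: complexI; rewrite cmodC normr1. Qed.

Lemma cmod_eq0 z : cmod z = 0 -> z = 0.
Proof. by move=> h; apply/normr0_eq0; rewrite -cmodC h. Qed.

Lemma cmod_sum (I : Type) (r : seq I) (f : I -> R[i]) :
  cmod (\sum_(i <- r) f i) <= \sum_(i <- r) cmod (f i).
Proof.
elim: r => [|a r IH]; first by rewrite !big_nil cmod0.
by rewrite !big_cons; apply: le_trans (cmodD _ _) _; rewrite lerD2l.
Qed.

Lemma Re_le_cmod z : `|complex.Re z| <= cmod z.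
Proof. by rewrite -lecR cmodC normc_ge_Re. Qed.

Lemma Im_le_cmod z : `|complex.Im z| <= cmod z.
Proof.
have -> : complex.Im z = - complex.Re (z * 'i%C) by rewrite ReiNIm opprK.
rewrite normrN; apply: le_trans (Re_le_cmod _) _.
rewrite cmodM -[leRHS]mulr1; apply: ler_wpM2l; first exact: cmod_ge0.
by rewrite -lecR cmodC normc_def /= expr0n expr1n add0r sqrtr1.
Qed.

Lemma Re_mul_real (a : R) z : complex.Re (a%:C%C * z) = a * complex.Re z.
Proof. by case: z => x y /=; rewrite mul0r subr0. Qed.

Lemma Im_mul_real (a : R) z : complex.Im (a%:C%C * z) = a * complex.Im z.
Proof. by case: z => x y /=; rewrite mul0r addr0. Qed.

Lemma Re_sum (I : Type) (r : seq I) (f : I -> R[i]) :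
  complex.Re (\sum_(i <- r) f i) = \sum_(i <- r) complex.Re (f i).
Proof. by apply: (big_morph (@complex.Re R)) => // -[a b] [c d]. Qed.

Lemma Im_sum (I : Type) (r : seq I) (f : I -> R[i]) :
  complex.Im (\sum_(i <- r) f i) = \sum_(i <- r) complex.Im (f i).
Proof. by apply: (big_morph (@complex.Im R)) => // -[a b] [c d]. Qed.

Definition remx m n (x : 'M[R[i]]_(m, n)) := map_mx (@complex.Re R) x.
Definition immx m n (x : 'M[R[i]]_(m, n)) := map_mx (@complex.Im R) x.

Lemma remxM m n p (A : 'M[R]_(m, n)) (x : 'M[R[i]]_(n, p)) :
  remx (cmx A *m x) = A *m remx x.
Proof.
apply/matrixP => i j; rewrite !mxE Re_sum; apply: eq_bigr => k _.
by rewrite !mxE Re_mul_real.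
Qed.

Lemma immxM m n p (A : 'M[R]_(m, n)) (x : 'M[R[i]]_(n, p)) :
  immx (cmx A *m x) = A *m immx x.
Proof.
apply/matrixP => i j; rewrite !mxE Im_sum; apply: eq_bigr => k _.
by rewrite !mxE Im_mul_real.
Qed.

Lemma remxD m n (x y : 'M[R[i]]_(m, n)) : remx (x + y) = remx x + remx y.
Proof. by apply/matrixP => i j; rewrite !mxE; case: (x i j) (y i j) => ? ? [? ?]. Qed.

Lemma immxD m n (x y : 'M[R[i]]_(m, n)) : immx (x + y) = immx x + immx y.
Proof. by apply/matrixP => i j; rewrite !mxE; case: (x i j) (y i j) => ? ? [? ?]. Qed.

Lemma remimx_eq m n (x y : 'M[R[i]]_(m, n)) :
  remx x = remx y -> immx x = immx y -> x = y.
Proof.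
move=> /matrixP hr /matrixP hi; apply/matrixP => i j.
have := hr i j; have := hi i j; rewrite !mxE.
by case: (x i j) (y i j) => ? ? [? ?] /= -> ->.
Qed.

Lemma remx_vec1 n (a : R[i]) : remx (a *: vec1 _ n) = complex.Re a *: vec1 R n.
Proof. by apply/matrixP => i j; rewrite !mxE !mulr1. Qed.

Lemma immx_vec1 n (a : R[i]) : immx (a *: vec1 _ n) = complex.Im a *: vec1 R n.
Proof. by apply/matrixP => i j; rewrite !mxE !mulr1. Qed.

Lemma cmxM m n p (A : 'M[R]_(m, n)) (B : 'M[R]_(n, p)) : cmx (A *m B) = cmx A *m cmx B.
Proof. exact: map_mxM. Qed.

Lemma cmxD m n (A B : 'M[R]_(m, n)) : cmx (A + B) = cmx A + cmx B.
Proof. exact: map_mxD. Qed.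

Lemma cmxX n (A : 'M[R]_n) k : cmx (A ^+ k) = cmx A ^+ k.
Proof.
elim: k => [|k IH]; first by rewrite !expr0; exact: map_mx1.
by rewrite !exprS -IH [LHS]cmxM.
Qed.

Lemma cmx_vec1 n : cmx (vec1 R n) = vec1 _ n.
Proof. by apply/matrixP => i j; rewrite !mxE. Qed.

Lemma cmx_inj m n (A B : 'M[R]_(m, n)) : cmx A = cmx B -> A = B.
Proof.
move=> /matrixP h; apply/matrixP => i j.
by have := h i j; rewrite !mxE => /complexI.
Qed.

End ComplexModulus.

Section Growth.
Variable R : realType.

(** The constant C = |a_0| + B / (r - |z|) is preserved by the recurrence. *)
Lemma recurrence_growth (z : R[i]) (r B : R) (a : nat -> R[i]) :
  cmod z < r -> 0 <= B ->
  (forall m, cmod (a m.+1 - z * a m) <= B * r ^+ m) ->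
  exists2 C, 0 <= C & forall m, cmod (a m) <= C * r ^+ m.
Proof.
move=> zr B0 h; have d0 : 0 < r - cmod z by lra.
have r0 : 0 < r by apply: le_lt_trans zr; exact: cmod_ge0.
pose C := cmod (a 0%N) + B / (r - cmod z).
have BC : 0 <= B / (r - cmod z) by rewrite divr_ge0 // ltW.
have C0 : 0 <= C by rewrite addr_ge0 // cmod_ge0.
exists C => //; elim=> [|m IH]; first by rewrite expr0 mulr1 /C; lra.
have -> : a m.+1 = (a m.+1 - z * a m) + z * a m by rewrite subrK.
apply: le_trans (cmodD _ _) _; rewrite cmodM.
apply: (@le_trans _ _ (B * r ^+ m + cmod z * (C * r ^+ m))).
  by apply: lerD => //; apply: ler_wpM2l => //; exact: cmod_ge0.
rewrite mulrA -mulrDl exprS mulrA; apply: ler_wpM2r; first by rewrite exprn_ge0 // ltW.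
have : B <= C * (r - cmod z).
  by rewrite -ler_pdivrMr // /C lerDr cmod_ge0.
by lra.
Qed.

Let shift_sub (z : R[i]) (a : nat -> R[i]) m := a m.+1 - z * a m.

Lemma recurrence_growth_seq (s : seq R[i]) (r : R) (a : nat -> R[i]) :
  0 < r -> (forall z, z \in s -> cmod z < r) ->
  (forall m, foldr shift_sub a s m = 0) ->
  exists2 C, 0 <= C & forall m, cmod (a m) <= C * r ^+ m.
Proof.
move=> r0 hs h.
suff : forall B, 0 <= B -> (forall m, cmod (foldr shift_sub a s m) <= B * r ^+ m) ->
    exists2 C, 0 <= C & forall m, cmod (a m) <= C * r ^+ m.
  by move=> /(_ 0 (lexx 0)); apply => m; rewrite h cmod0 mul0r.
elim: s hs {h} => [|z s IH] hs B B0 h; first by exists B.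
have [|C C0 hC] := @recurrence_growth z r B (foldr shift_sub a s) _ B0 h.
  by apply: hs; rewrite mem_head.
by apply: (IH _ C C0 hC) => w ws; apply: hs; rewrite inE ws orbT.
Qed.

Lemma foldr_shift_entry n (A : 'M[R[i]]_n.+1) (s : seq R[i]) i j m :
  foldr shift_sub (fun m => (A ^+ m) i j) s m =
  ((horner_mx A (\prod_(z <- s) ('X - z%:P))) * A ^+ m) i j.
Proof.
elim: s m => [|z s IH] m; first by rewrite big_nil rmorph1 mul1r.
rewrite /= /shift_sub !IH big_cons [('X - z%:P) * _]mulrC rmorphM rmorphB /= horner_mx_X horner_mx_C.
set Q := horner_mx A _.
transitivity ((Q * A ^+ m.+1 - z *: (Q * A ^+ m)) i j).
  by rewrite entryD entryN entryZ.
congr (fun_of_matrix _ i j).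
rewrite -mulrA mulrBl -exprS mulrBr; congr (_ - _).
by rewrite -scalemx1 -scalerAl mul1r scalerAr.
Qed.

(** By the Cayley-Hamilton theorem every entry of A^m satisfies the linear
    recurrence whose characteristic roots are the eigenvalues; the factors are
    removed one after the other with [recurrence_growth]. *)
Lemma power_growth n (A : 'M[R[i]]_n) (r : R) : 0 < r ->
  (forall z, eigenvalue A z -> cmod z < r) ->
  exists2 C, 0 <= C & forall m i j, cmod ((A ^+ m) i j) <= C * r ^+ m.
Proof.
case: n A => [|n] A r0 h; first by exists 0 => // m [].
have [s sE] := closed_field_poly_normal (char_poly A).
rewrite (monicP (char_poly_monic A)) scale1r in sE.
have hs z : z \in s -> cmod z < r.
  by move=> zs; apply: h; rewrite eigenvalue_root_char sE root_prod_XsubC.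
have ent i j : exists2 C, 0 <= C & forall m, cmod ((A ^+ m) i j) <= C * r ^+ m.
  apply: (recurrence_growth_seq r0 hs) => m.
  by rewrite foldr_shift_entry -sE Cayley_Hamilton [0 * _]mul0mx mxE.
have {}ent (p : 'I_n.+1 * 'I_n.+1) : exists C, 0 <= C /\ forall m, cmod ((A ^+ m) p.1 p.2) <= C * r ^+ m.
  by have [C ? ?] := ent p.1 p.2; exists C.
have [C hC] := boolp.choice ent.
have C0 p : 0 <= C p by have [] := hC p.
exists (\sum_p C p); first exact: sumr_ge0.
move=> m i j; have [_ h1] := hC (i, j); apply: le_trans (h1 m) _.
apply: ler_wpM2r; first by rewrite exprn_ge0 // ltW.
by rewrite (bigD1 (i, j)) //= lerDl; exact: sumr_ge0.
Qed.

Lemma power_growth_real n (A : 'M[R]_n) (r : R) : 0 < r ->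
  (forall z, eigenvalue (cmx A) z -> cmod z < r) ->
  exists2 C, 0 <= C & forall m i j, `|(A ^+ m) i j| <= C * r ^+ m.
Proof.
move=> r0 /(power_growth r0)[C C0 h]; exists C => // m i j.
by rewrite -cmod_real; have := h m i j; rewrite -cmxX mxE.
Qed.

End Growth.

(** Left and right eigenvectors give the same spectrum. *)
Lemma eigenvalue_colP (F : fieldType) n (A : 'M[F]_n) z :
  eigenvalue A z <-> exists2 x : 'cV[F]_n, x != 0 & A *m x = z *: x.
Proof.
rewrite /eigenvalue /eigenspace kermx_eq0 row_free_unit; split=> [uA|[x x0 Ax]].
  apply: contrapT => hno; move/negP: uA; apply; apply: inj_unitmx => x.
  rewrite mulmxBl mul_scalar_mx => /eqP; rewrite subr_eq0 => /eqP Ax.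
  by apply: contrapT => /eqP x0; apply: hno; exists x.
apply/negP => uA; move/negP: x0; apply; apply/eqP.
by rewrite -(mulKmx uA x) mulmxBl mul_scalar_mx Ax subrr mulmx0.
Qed.

Lemma seq_max (T : eqType) (R : realDomainType) (f : T -> R) (s : seq T) :
  s != [::] -> exists2 z, z \in s & forall w, w \in s -> f w <= f z.
Proof.
elim: s => // a s IH _; have [->|s0] := eqVneq s [::].
  by exists a; rewrite ?mem_head // => w; rewrite inE => /eqP ->.
have [z zs hz] := IH s0; have [az|za] := leP (f a) (f z).
  exists z; first by rewrite inE zs orbT.
  by move=> w; rewrite inE => /orP[/eqP ->|/hz].
exists a; first by rewrite mem_head.
move=> w; rewrite inE => /orP[/eqP ->//|/hz h].
exact: le_trans h (ltW za).
Qed.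

Lemma spectral_radius_attained (R : realType) n (A : 'M[R]_n) : (0 < n)%N ->
  (exists2 z, eigenvalue (cmx A) z & cmod z = spectral_radius A) /\
  (forall z, eigenvalue (cmx A) z -> cmod z <= spectral_radius A).
Proof.
case: n A => // n A _.
have [s sE] := closed_field_poly_normal (char_poly (cmx A)).
rewrite (monicP (char_poly_monic _)) scale1r in sE.
have es z : eigenvalue (cmx A) z = (z \in s).
  by rewrite eigenvalue_root_char sE root_prod_XsubC.
have sn0 : s != [::].
  apply/negP => /eqP s0; have := size_char_poly (cmx A).
  by rewrite sE s0 big_nil size_poly1.
have [z zs zmax] := seq_max (@cmod R) sn0.
have ub : has_ubound [set r : R | exists2 z : R[i], eigenvalue (cmx A) z & r = cmod z].
  by exists (cmod z) => _ [w ew ->]; apply: zmax; rewrite -es.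
have le w : eigenvalue (cmx A) w -> cmod w <= spectral_radius A.
  by move=> ew; apply: ub_le_sup => //; exists w.
split=> //; exists z; first by rewrite es.
apply/le_anti/andP; split; first by apply: le; rewrite es.
apply: ge_sup; first by exists (cmod z), z; rewrite ?es.
by move=> _ [w ew ->]; apply: zmax; rewrite -es.
Qed.

(** In the basis made of the vector 1 and of the last n coordinate vectors, A
    is block triangular with upper left block 1, so q is the characteristic
    polynomial of the other block, for which 1 is not an eigenvalue. *)
Lemma simple_root_eigenvector (F : fieldType) n (A : 'M[F]_n.+1) (q : {poly F}) x :
  A *m vec1 F n.+1 = vec1 F n.+1 -> char_poly A = ('X - 1%:P) * q -> ~~ root q 1 ->
  A *m x = x -> x = x 0 0 *: vec1 F n.+1.
Proof.
move=> A1 cA q1 Ax.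
pose B : 'M[F]_(1 + n) := A.
pose a := ulsubmx B; pose b := ursubmx B; pose c := dlsubmx B; pose d := drsubmx B.
have eB : B = block_mx a b c d by rewrite submxK.
have v1 : vec1 F n.+1 = col_mx (vec1 F 1) (vec1 F n) :> 'cV[F]_(1 + n).
  by rewrite /vec1 col_mx_const.
pose P : 'M[F]_(1 + n) := block_mx 1%:M 0 (vec1 F n) 1%:M.
pose T : 'M[F]_(1 + n) := block_mx 1%:M b 0 (d - vec1 F n *m b).
have [e1 e2] : a *m vec1 F 1 + b *m vec1 F n = vec1 F 1 /\
               c *m vec1 F 1 + d *m vec1 F n = vec1 F n.
  by apply: eq_col_mx; rewrite -mul_block_col -eB -v1.
have v11 : vec1 F 1 = 1%:M by apply/matrixP => i j; rewrite !ord1 !mxE eqxx.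
rewrite v11 !mulmx1 in e1 e2.
have BP : B *m P = P *m T.
  rewrite eB /P /T !mulmx_block !mulmx1 !mul1mx !mulmx0 !mul0mx ?add0r ?addr0 e1 e2.
  by rewrite addrC subrK.
have detP : \det (map_mx (@polyC F) P) = 1.
  by rewrite det_map_mx det_lblock !det1 mulr1.
have cT : char_poly B = char_poly T.
  have : char_poly_mx B *m map_mx (@polyC F) P = map_mx (@polyC F) P *m char_poly_mx T.
    rewrite /char_poly_mx mulmxBl mulmxBr -!map_mxM BP.
    by rewrite mul_scalar_mx mul_mx_scalar.
  by move/(congr1 determinant); rewrite !det_mulmx detP mulr1 mul1r.
have cT2 : char_poly T = ('X - 1%:P) * char_poly (d - vec1 F n *m b).
  rewrite /char_poly /char_poly_mx /T map_block_mx /= map_mx0 map_scalar_mx.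
  rewrite scalar_mx_block opp_block_mx add_block_mx !oppr0 !addr0 add0r det_ublock.
  congr (_ * _); rewrite det_mx11 !mxE.
  by rewrite eqxx mulr1n.
have qE : q = char_poly (d - vec1 F n *m b).
  by apply: (mulfI (negbT (polyXsubC_eq0 (1 : F)))); rewrite -cA -cT2 -cT.
pose w : 'cV[F]_(1 + n) := x - x 0 0 *: vec1 F n.+1.
have w0 : usubmx w = 0.
  apply/matrixP => i j; rewrite !ord1 !mxE.
  have -> : lshift n 0 = 0 :> 'I_(1 + n) by apply: val_inj.
  by rewrite mulr1 subrr.
have [v wE] : exists v, w = col_mx 0 v by exists (dsubmx w); rewrite -w0 vsubmxK.
have Bw : B *m w = w by rewrite mulmxBr -scalemxAr Ax A1.
suff v0 : v = 0 by apply/eqP; rewrite -subr_eq0 -/w wE v0 col_mx0.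
apply: contrapT => /eqP vn0; move/negP: q1; apply.
have [f1 f2] : b *m v = 0 /\ d *m v = v.
  by apply: eq_col_mx; move: Bw; rewrite wE eB mul_block_col !mulmx0 !add0r.
rewrite qE.
have : eigenvalue (d - vec1 F n *m b) 1.
  apply/eigenvalue_colP; exists (v) => //.
  by rewrite mulmxBl -mulmxA f1 f2 mulmx0 subr0 scale1r.
case: (n) (d - _) => [|n'] D; last by rewrite eigenvalue_root_char.
by move=> /eigenvalue_colP [y /negP yn0]; case: yn0; apply/eqP/matrixP => -[].
Qed.

(** * Entrywise norm and deflation of the eigenvalue 1 *)

Section EntrySum.
Variable R : realType.

Definition entry_norm m n (A : 'M[R]_(m, n)) : R := \sum_i \sum_j `|A i j|.

Lemma entry_norm_ge0 m n (A : 'M[R]_(m, n)) : 0 <= entry_norm A.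
Proof. by do 2!(apply: sumr_ge0 => ? _). Qed.

Lemma entry_le_norm m n (A : 'M[R]_(m, n)) i j : `|A i j| <= entry_norm A.
Proof.
rewrite /entry_norm (bigD1 i) //= (bigD1 j) //= -addrA lerDl.
by rewrite addr_ge0 // ?sumr_ge0 // => *; rewrite sumr_ge0.
Qed.

Lemma entry_normM m n p (A : 'M[R]_(m, n)) (B : 'M[R]_(n, p)) :
  entry_norm (A *m B) <= entry_norm A * entry_norm B.
Proof.
rewrite /entry_norm mulr_suml; apply: ler_sum => i _.
apply: (@le_trans _ _ (\sum_j \sum_k `|A i k| * `|B k j|)).
  apply: ler_sum => j _; rewrite mxE; apply: le_trans (ler_norm_sum _ _ _) _.
  by apply: ler_sum => k _; rewrite normrM.
rewrite exchange_big /= mulr_suml; apply: ler_sum => k _.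
rewrite -mulr_sumr; apply: ler_wpM2l => //.
by rewrite [leRHS](bigD1 k) //= lerDl; do 2!(apply: sumr_ge0 => ? _).
Qed.

Lemma entry_normD m n (A B : 'M[R]_(m, n)) :
  entry_norm (A + B) <= entry_norm A + entry_norm B.
Proof.
rewrite /entry_norm -big_split; apply: ler_sum => i _; rewrite -big_split /=.
by apply: ler_sum => j _; rewrite mxE ler_normD.
Qed.

Lemma entry_normN m n (A : 'M[R]_(m, n)) : entry_norm (- A) = entry_norm A.
Proof. by do 2!(apply: eq_bigr => ? _); rewrite mxE normrN. Qed.

Lemma entry_norm_bound m n (A : 'M[R]_(m, n)) C :
  (forall i j, `|A i j| <= C) -> entry_norm A <= C *+ n *+ m.
Proof.
move=> h; rewrite /entry_norm -[X in _ *+ X]card_ord -sumr_const; apply: ler_sum => i _.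
by rewrite -[X in _ *+ X]card_ord -sumr_const; apply: ler_sum.
Qed.

Lemma entry_norm_row_mx m n p (A : 'M[R]_(m, n)) (B : 'M[R]_(m, p)) :
  entry_norm (row_mx A B) = entry_norm A + entry_norm B.
Proof.
rewrite /entry_norm -big_split; apply: eq_bigr => i _; rewrite big_split_ord /=.
by congr (_ + _); apply: eq_bigr => j _; rewrite ?row_mxEl ?row_mxEr.
Qed.

Lemma entry_norm_growth n (A : nat -> 'M[R]_n) r C : 0 <= r ->
  (forall m i j, `|A m i j| <= C * r ^+ m) ->
  forall m, entry_norm (A m) <= C *+ n *+ n * r ^+ m.
Proof.
move=> r0 h m; apply: le_trans (entry_norm_bound (h m)) _.
by rewrite -!mulrnAl.
Qed.

Lemma substochastic_norm n (A : 'M[R]_n) : nonneg_mx A ->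
  A *m vec1 R n <=m vec1 R n -> entry_norm A <= n%:R.
Proof.
move=> /nonneg_mxP A0 A1; rewrite /entry_norm -[X in X%:R]card_ord -sumr_const.
apply: ler_sum => i _; have := A1 i 0; rewrite row_sumE mxE.
by under eq_bigr do rewrite -(ger0_norm (A0 _ _)).
Qed.

End EntrySum.

Section Deflation.
Variables (R : realType) (n : nat) (W : 'M[R]_n) (i0 : 'I_n).
Hypothesis hW : stochastic W.

(** The projection along 1 onto the vectors with zero entry at i0. *)
Definition deflator : 'M[R]_n := 1%:M - vec1 R n *m delta_mx 0 i0.
Let D := deflator *m W.

Lemma delta_vec1 : delta_mx 0 i0 *m vec1 R n = 1%:M :> 'M[R]_1.
Proof.
apply/matrixP => i j; rewrite !ord1 !mxE (bigD1 i0) //= big1 => [|k ki].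
  by rewrite !mxE !eqxx mulr1 addr0.
by rewrite !mxE eqxx (negbTE ki) mul0r.
Qed.

Lemma deflator_vec1 : deflator *m vec1 R n = 0.
Proof. by rewrite mulmxBl mul1mx -mulmxA delta_vec1 mulmx1 subrr. Qed.

Lemma mul_deflator m (K : 'M[R]_(m, n)) : K *m vec1 R n = 0 -> K *m deflator = K.
Proof. by move=> K1; rewrite mulmxBr mulmx1 mulmxA K1 mul0mx subr0. Qed.

(** Powers of the projected matrix are projections of powers, because 1 is
    fixed by W and killed by the projection. *)
Lemma deflator_expr m : deflator *m W ^+ m = D ^+ m *m deflator.
Proof.
have [_ W1] := hW.
elim: m => [|m IH]; first by rewrite !expr0 mul1mx mulmx1.
have -> : D ^+ m.+1 *m deflator = D *m (D ^+ m *m deflator).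
  by rewrite exprS -mulmxA.
rewrite -IH [RHS]mulmxA mul_deflator; last by rewrite -mulmxA W1 deflator_vec1.
by rewrite exprS /D -mulmxA.
Qed.

Lemma stochastic_shift_complex (x : 'cV[R[i]]_n) (a : R[i]) :
  cmx W *m x = x + a *: vec1 _ n -> a = 0.
Proof.
move=> h.
have hr : W *m remx x = remx x + complex.Re a *: vec1 R n.
  by rewrite -remxM h remxD remx_vec1.
have hi : W *m immx x = immx x + complex.Im a *: vec1 R n.
  by rewrite -immxM h immxD immx_vec1.
have := stochastic_shift i0 hW hr; have := stochastic_shift i0 hW hi.
by case: (a) => ? ? /= -> ->.
Qed.

(** An eigenvector x of the deflated matrix satisfies W x = mu x + a 1; for mu
    <> 1 adding a multiple of 1 makes it an eigenvector of W, and for mu = 1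
    the shift a vanishes. *)
Lemma deflated_eigenvalue (Q : R[i] -> Prop) : Q 0 ->
  (forall mu (x : 'cV[R[i]]_n), x != 0 -> cmx W *m x = mu *: x ->
    (exists a, x = a *: vec1 _ n) \/ Q mu) ->
  forall mu, eigenvalue (cmx D) mu -> Q mu.
Proof.
move=> Q0 hQ mu /eigenvalue_colP[x xn0 Dx]; have [_ W1] := hW.
have [->|mu0] := eqVneq mu 0; first by [].
pose a := (cmx W *m x) i0 0.
have eD : cmx W *m x = mu *: x + a *: vec1 _ n.
  rewrite -Dx /D cmxM.
  have -> : cmx deflator = 1%:M - vec1 _ n *m delta_mx 0 i0.
    rewrite /deflator /cmx map_mxD map_mxN map_mx1 [map_mx _ (_ *m _)]map_mxM map_delta_mx.
    by rewrite -[map_mx _ (vec1 R n)]/(cmx _) cmx_vec1.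
  rewrite -mulmxA mulmxBl mul1mx -mulmxA.
  have -> : delta_mx 0 i0 *m (cmx W *m x) = a%:M.
    apply/matrixP => i j; rewrite !ord1 mxE (bigD1 i0) //= big1 => [|k ki].
      by rewrite [delta_mx _ _ _ _]mxE !eqxx mul1r addr0 [RHS]mxE eqxx mulr1n.
    by rewrite mxE eqxx (negbTE ki) mul0r.
  by rewrite mul_mx_scalar subrK.
have x0 : x i0 0 = 0.
  apply: (mulfI mu0); rewrite mulr0 -entryZ.
  have -> : mu *: x = cmx W *m x - a *: vec1 _ n by rewrite eD addrK.
  by rewrite entryD entryN entryZ [vec1 _ _ _ _]mxE mulr1 subrr.
have nprop c : x <> c *: vec1 _ n.
  move=> xc; move/negP: xn0; apply; apply/eqP; move: x0.
  by rewrite {1}xc !mxE mulr1 => c0; rewrite xc c0 scale0r.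
have [mu1|mu1] := eqVneq mu 1.
  move: eD; rewrite mu1 scale1r => eD.
  have a0 := stochastic_shift_complex eD.
  move: eD; rewrite a0 scale0r addr0 => eD.
  have [|[c /nprop //]|] := hQ 1 x xn0; first by rewrite scale1r.
  by rewrite ?mu1.
pose b := a / (mu - 1).
have mu10 : mu - 1 != 0 by rewrite subr_eq0.
have W1c : cmx W *m vec1 _ n = vec1 _ n by rewrite -!cmx_vec1 -cmxM W1.
have := hQ mu (x + b *: vec1 _ n); case.
- apply/negP; rewrite addr_eq0 => /eqP h.
  by apply: (nprop (- b)); rewrite scaleNr.
- rewrite mulmxDr -scalemxAr W1c eD scalerDr -addrA -scalerDl scalerA.
  by congr (_ + _ *: _); rewrite /b; field.
- by move=> [c h]; case: (nprop (c - b)); rewrite scalerBl -h addrK.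
- by [].
Qed.

Lemma deflated_growth (r : R) : 0 < r ->
  (forall mu (x : 'cV[R[i]]_n), x != 0 -> cmx W *m x = mu *: x ->
    (exists a, x = a *: vec1 _ n) \/ cmod mu < r) ->
  exists2 C, 0 <= C & forall m, entry_norm (deflator *m W ^+ m) <= C * r ^+ m.
Proof.
move=> r0 h.
have hD mu : eigenvalue (cmx D) mu -> cmod mu < r.
  by apply: (deflated_eigenvalue (Q := fun mu => cmod mu < r)); rewrite ?cmod0.
have [C C0 hC] := power_growth_real r0 hD.
have hE := entry_norm_growth (ltW r0) hC.
exists (C *+ n *+ n * entry_norm deflator).
  by rewrite mulr_ge0 ?entry_norm_ge0 ?mulrn_wge0.
move=> m; rewrite deflator_expr; apply: le_trans (entry_normM _ _) _.
by rewrite mulrAC; apply: ler_wpM2r; [exact: entry_norm_ge0|exact: hE].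
Qed.

Lemma deflated_growth_lt1 :
  (forall mu (x : 'cV[R[i]]_n), x != 0 -> cmx W *m x = mu *: x ->
    (exists a, x = a *: vec1 _ n) \/ cmod mu < 1) ->
  exists C r, [/\ 0 <= C, 0 < r, r < 1 &
    forall m, entry_norm (deflator *m W ^+ m) <= C * r ^+ m].
Proof.
move=> h.
have hD mu : eigenvalue (cmx D) mu -> cmod mu < 1.
  by apply: (deflated_eigenvalue (Q := fun mu => cmod mu < 1)); rewrite ?cmod0.
have [[z ez zr] rmax] := spectral_radius_attained D (leq_ltn_trans (leq0n i0) (ltn_ord i0)).
pose r := (1 + spectral_radius D) / 2.
have rho1 : spectral_radius D < 1 by rewrite -zr; exact: hD.
have rho0 : 0 <= spectral_radius D by rewrite -zr cmod_ge0.
have r0 : 0 < r by rewrite /r; lra.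
have [C C0 hC] : exists2 C, 0 <= C & forall m i j, `|(D ^+ m) i j| <= C * r ^+ m.
  apply: power_growth_real => // w /rmax; rewrite /r; lra.
have hE := entry_norm_growth (ltW r0) hC.
exists (C *+ n *+ n * entry_norm deflator), r; split=> //.
- by rewrite mulr_ge0 ?entry_norm_ge0 ?mulrn_wge0.
- by rewrite /r; lra.
move=> m; rewrite deflator_expr; apply: le_trans (entry_normM _ _) _.
by rewrite mulrAC; apply: ler_wpM2r; [exact: entry_norm_ge0|exact: hE].
Qed.

Lemma deflator_rows m i i' j : 
  `|(W ^+ m) i j - (W ^+ m) i' j| <= 2 * entry_norm (deflator *m W ^+ m).
Proof.
have e k : (deflator *m W ^+ m) k j = (W ^+ m) k j - (W ^+ m) i0 j.
  rewrite mulmxBl mul1mx entryD entryN -mulmxA; congr (_ - _).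
  rewrite mxE big_ord1 mxE mul1r mxE (bigD1 i0) //= big1 => [|l li].
    by rewrite mxE !eqxx mul1r addr0.
  by rewrite mxE (negbTE li) andbF mul0r.
have -> : (W ^+ m) i j - (W ^+ m) i' j =
  (deflator *m W ^+ m) i j - (deflator *m W ^+ m) i' j by rewrite !e; ring.
apply: le_trans (ler_normB _ _) _.
have := entry_le_norm (deflator *m W ^+ m) i j.
by have := entry_le_norm (deflator *m W ^+ m) i' j; lra.
Qed.

End Deflation.

Section UpwardSpectrum.
Variables (R : realType) (n : nat) (Bm B0 Bp G V : 'M[R]_n).
Hypothesis hBm : nonneg_mx Bm.
Hypothesis hB0 : nonneg_mx B0.
Hypothesis hBp : nonneg_mx Bp.
Hypothesis hB : (Bm + B0 + Bp) *m vec1 R n = vec1 R n.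
Hypothesis minG : minimal_nonneg_solution (qbd_solution Bm B0 Bp) G.
Hypothesis minV : minimal_nonneg_solution (qbd_solution Bp B0 Bm) V.
Hypothesis hG1 : G *m vec1 R n = vec1 R n.
Hypothesis hmod1 : forall z : R[i], eigenvalue (cmx G) z -> cmod z = 1 -> z = 1.
Hypothesis simple1 : forall x : 'cV[R[i]]_n, cmx G *m x = x ->
  exists a, x = a *: vec1 _ n.

(** The constant sequence x is harmonic and bounded, hence x = G x. *)
Lemma harmonic_constant (x : 'cV[R]_n) :
  (Bm + B0 + Bp) *m x = x -> exists a, x = a *: vec1 R n.
Proof.
move=> hx.
have Gx : x = G *m x.
  apply: (harmonic_bounded hBm hB0 hBp hB minG hG1 (f := fun=> x)
    (C := \sum_i `|x i 0|) _ _ 0%N).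
    by move=> _ i; rewrite (bigD1 i) //= lerDl; apply: sumr_ge0.
  by move=> j; rewrite /harmonic_at -!mulmxDl.
have [a ea] : exists a, cmx x = a *: vec1 _ n by apply: simple1; rewrite -cmxM -Gx.
exists (complex.Re a); rewrite -remx_vec1 -ea.
by apply/matrixP => i j; rewrite !mxE.
Qed.

(** If V x = z x with |z| = 1, the sequence z^-j x is harmonic on all levels
    and bounded, so G x = z^-1 x. *)
Lemma unimodular_V z (x : 'cV[R[i]]_n) : x != 0 -> cmx V *m x = z *: x ->
  cmod z = 1 -> z = 1 /\ exists a, x = a *: vec1 _ n.
Proof.
move=> xn0 Vx z1; have [V0 eV _] := minV.
have zn0 : z != 0 by apply/negP => /eqP z0; move: z1; rewrite z0 cmod0 => /esym/eqP; rewrite oner_eq0.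
pose w := z^-1.
have w1 : cmod w = 1 by rewrite cmodV z1 invr1.
pose c j := w ^+ j *: x.
have ch j : cmx Bm *m c j + cmx B0 *m c j.+1 + cmx Bp *m c j.+2 = c j.+1.
  have e : z *: x = cmx Bp *m x + z *: (cmx B0 *m x) + z ^+ 2 *: (cmx Bm *m x).
    have eVx : cmx V *m x = cmx Bp *m x + cmx B0 *m (cmx V *m x)
        + cmx Bm *m (cmx V *m (cmx V *m x)).
      by rewrite {1}eV 2!cmxD !cmxM !mulmxDl -!mulmxA.
    by rewrite -[LHS]Vx eVx Vx -!scalemxAr Vx -scalemxAr scalerA expr2.
  have -> : c j.+1 = w ^+ j.+2 *: (z *: x).
    by rewrite scalerA exprSr -mulrA mulVf // mulr1.
  rewrite /c -!scalemxAr e !scalerDr !scalerA.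
  have -> : w ^+ j.+2 * z = w ^+ j.+1 by rewrite exprSr -mulrA mulVf // mulr1.
  have -> : w ^+ j.+2 * z ^+ 2 = w ^+ j.
    by rewrite 2!exprSr expr2 -!mulrA (mulrA w z) mulVf // mul1r mulVf // mulr1.
  by mx_abel.
have bnd j i : cmod (c j i 0) <= \sum_i cmod (x i 0).
  rewrite entryZ cmodM cmodX w1 expr1n mul1r (bigD1 i) //= lerDl.
  by apply: sumr_ge0 => *; exact: cmod_ge0.
have reG : remx (c 1%N) = G *m remx (c 0%N).
  apply: (harmonic_bounded hBm hB0 hBp hB minG hG1 (f := fun j => remx (c j))
    (C := \sum_i cmod (x i 0)) _ _ 0%N).
    by move=> j i; rewrite mxE; apply: le_trans (Re_le_cmod _) _.
  by move=> j; rewrite /harmonic_at -!remxM -!remxD ch.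
have imG : immx (c 1%N) = G *m immx (c 0%N).
  apply: (harmonic_bounded hBm hB0 hBp hB minG hG1 (f := fun j => immx (c j))
    (C := \sum_i cmod (x i 0)) _ _ 0%N).
    by move=> j i; rewrite mxE; apply: le_trans (Im_le_cmod _) _.
  by move=> j; rewrite /harmonic_at -!immxM -!immxD ch.
have Gx : cmx G *m x = w *: x.
  have c0 : c 0%N = x by rewrite /c expr0 scale1r.
  have c1 : c 1%N = w *: x by rewrite /c expr1.
  by apply: remimx_eq; rewrite ?remxM ?immxM -c1 -{1}c0 ?reG ?imG.
have ww : w = 1.
  by apply: hmod1 => //; apply/eigenvalue_colP; exists x.
split; first by rewrite -[z]invrK -/w ww invr1.
by apply: simple1; rewrite Gx ww scale1r.
Qed.

Lemma V_le1 : V *m vec1 R n <=m vec1 R n.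
Proof.
apply: (minimal_solution_sub hBp hB0 hBm _ minV).
by rewrite -[RHS]hB; congr (_ *m _); mx_abel.
Qed.

Lemma V_spectrum_le1 z : eigenvalue (cmx V) z -> cmod z <= 1.
Proof.
case/eigenvalue_colP=> x xn0 Vx; have [/nonneg_mxP V0 _ _] := minV.
have [i xi] : exists i, x i 0 != 0.
  apply: contrapT => h; move/negP: xn0; apply; apply/eqP/matrixP => i j.
  rewrite ord1 mxE; apply/eqP; apply: contrapT => /negP hi; apply: h; by exists i.
have [k _ kmax] := @arg_maxP _ _ _ i xpredT (fun i => cmod (x i 0)) isT.
have xk : 0 < cmod (x k 0).
  apply: lt_le_trans (kmax i isT); rewrite lt_neqAle cmod_ge0 andbT eq_sym.
  by apply/negP => /eqP/cmod_eq0/eqP; rewrite (negbTE xi).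
rewrite -(ler_pM2r xk) mul1r -cmodM -entryZ -Vx mxE.
apply: le_trans (cmod_sum _ _) _.
apply: (@le_trans _ _ (\sum_j V k j * cmod (x k 0))).
  apply: ler_sum => j _; rewrite cmodM mxE cmod_real (ger0_norm (V0 _ _)).
  by apply: ler_wpM2l => //; exact: kmax.
rewrite -mulr_suml -row_sumE -[leRHS]mul1r; apply: ler_wpM2r; first exact: ltW.
by apply: le_trans (V_le1 k 0) _; rewrite mxE.
Qed.

Variable i0 : 'I_n.

Lemma V_stochastic : spectral_radius V = 1 -> V *m vec1 R n = vec1 R n.
Proof.
move=> rho1.
have [[z ez zr] _] := spectral_radius_attained V (leq_ltn_trans (leq0n i0) (ltn_ord i0)).
have [x xn0 Vx] := (eigenvalue_colP _ _).1 ez.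
have [z1 [a xa]] := unimodular_V xn0 Vx (etrans zr rho1).
have an0 : a != 0 by apply/negP => /eqP a0; move: xn0; rewrite xa a0 scale0r eqxx.
apply: cmx_inj; rewrite cmxM cmx_vec1.
have : a *: (cmx V *m vec1 _ n) = a *: vec1 _ n.
  by rewrite scalemxAr -xa Vx z1 scale1r.
by move/(congr1 (fun M => a^-1 *: M)); rewrite !scalerA mulVf // !scale1r.
Qed.

Lemma V_deflated_spectrum mu (x : 'cV[R[i]]_n) : x != 0 -> cmx V *m x = mu *: x ->
  (exists a, x = a *: vec1 _ n) \/ cmod mu < 1.
Proof.
move=> xn0 Vx.
have : cmod mu <= 1 by apply: V_spectrum_le1; apply/eigenvalue_colP; exists x.
rewrite le_eqVlt => /orP[/eqP mu1|]; last by right.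
by left; have [] := unimodular_V xn0 Vx mu1.
Qed.

End UpwardSpectrum.

(** * Bounds on the SDA iterates *)

Lemma geometric_cvg0 (R : realType) (a : nat -> R) C r : 0 <= r -> r < 1 ->
  (forall m, `|a m| <= C * r ^+ m) -> a @ \oo --> (0 : R).
Proof.
move=> r0 r1 h; apply/norm_cvg0P.
have c : (fun m => C * r ^+ m) @ \oo --> (0 : R).
  rewrite -[X in _ --> X](mulr0 C); apply: cvgM; first exact: cvg_cst.
  by apply: cvg_expr; rewrite ger0_norm.
apply: (squeeze_cvgr _ (cvg_cst 0) c).
by apply: nearW => m; rewrite normr_ge0 h.
Qed.

Section SDAAnalysis.
Variables (R : realType) (n : nat) (i0 : 'I_n) (Bm B0 Bp G V Gt : 'M[R]_n).
Hypothesis hBm : nonneg_mx Bm.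
Hypothesis hB0 : nonneg_mx B0.
Hypothesis hBp : nonneg_mx Bp.
Hypothesis hB : (Bm + B0 + Bp) *m vec1 R n = vec1 R n.
Hypothesis minG : minimal_nonneg_solution (qbd_solution Bm B0 Bp) G.
Hypothesis minV : minimal_nonneg_solution (qbd_solution Bp B0 Bm) V.
Hypothesis hG1 : G *m vec1 R n = vec1 R n.
Hypothesis hGt : stochastic Gt.
Variables (E F P Q : nat -> 'M[R]_n).
Let M := 1%:M - B0 - Bp *m Gt.
Hypothesis unitM : M \in unitmx.
Hypothesis P0E : M *m P 0%N = Bp *m Gt *m Gt + (B0 - 1%:M) *m Gt + Bm.
Hypothesis E0E : E 0%N = Gt + P 0%N.
Hypothesis F0E : M *m F 0%N = Bp.
Hypothesis Q0E : Q 0%N = F 0%N.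
Hypothesis hSDA : SDA E F P Q.

Let H := G - Gt.
Let U k := Gt + P k.
Let Psi k := F k *m invmx (1%:M - P k *m Q k).

Let transfer m (x : nat -> 'M[R]_(n, m)) k
    (hx : forall l, (l < 2 ^ k)%N -> harmonic_at Bm B0 Bp x l) :
  (x 1%N - Gt *m x 0%N) - P k *m x 0%N =
    F k *m (x (2 ^ k).+1 - Gt *m x (2 ^ k)%N).
Proof. by have [] := SDA_transfer unitM P0E E0E F0E Q0E hSDA (j := 0%N) hx. Qed.

Let transfer_up m (x : nat -> 'M[R]_(n, m)) k
    (hx : forall l, (l < 2 ^ k)%N -> harmonic_at Bm B0 Bp x l) :
  (x 1%N - Gt *m x 0%N) - P k.+1 *m x 0%N =
    Psi k *m (x (2 ^ k).+1 - U k *m x (2 ^ k)%N).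
Proof. exact: (SDA_transfer_reflect unitM P0E E0E F0E Q0E hSDA hx). Qed.

Let Gharm l : harmonic_at Bm B0 Bp (fun j => G ^+ j) l.
Proof. by apply: harmonic_expr; case: minG. Qed.

Lemma H_vec1 : H *m vec1 R n = 0.
Proof. by have [_ Gt1] := hGt; rewrite mulmxBl hG1 Gt1 subrr. Qed.

(** Transfer along the sequence G^j. *)
Lemma SDA_error k : H - P k = F k *m H *m G ^+ (2 ^ k).
Proof.
have := @transfer _ (fun j => G ^+ j) k (fun l _ => Gharm l).
rewrite expr0 expr1 !mulmx1 => ->; rewrite -mulmxA; congr (_ *m _).
by rewrite mulmxBl exprS.
Qed.

(** Reflected transfer along the sequence G^j. *)
Lemma SDA_error_step k : H - P k.+1 = Psi k *m ((H - P k) *m G ^+ (2 ^ k)).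
Proof.
have := @transfer_up _ (fun j => G ^+ j) k (fun l _ => Gharm l).
rewrite expr0 expr1 !mulmx1 => ->; congr (_ *m _).
by rewrite exprS -mulmxBl /H /U opprD addrA.
Qed.

Lemma SDA_P_vec1 k : P k *m vec1 R n = 0.
Proof.
apply/eqP; rewrite -oppr_eq0 -[X in - X]subr0 opprB -H_vec1 -mulmxBl SDA_error.
by rewrite -!mulmxA expr_vec1 // H_vec1 mulmx0.
Qed.

Lemma no_trap_initial k : no_trap Bm B0 Bp Gt (2 ^ k).
Proof.
move=> x x0 xr hx l hl.
have [] // := SDA_unique unitM P0E E0E F0E Q0E hSDA (x := x) (k := k) (j := 0%N) hx x0 _ hl.
by rewrite add0n xr subrr.
Qed.

(** Reflecting by Gt at the top makes y_N = 0, so column i of Gt + P_k is the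
    value at level 1 of the harmonic function equal to the i-th unit vector at
    level 0. *)
Lemma SDA_stochastic k : stochastic (U k).
Proof.
have [Gt0 Gt1] := hGt.
split; last by rewrite mulmxDl SDA_P_vec1 addr0.
apply/nonneg_mxP => a i.
pose e : 'cV[R]_n := delta_mx i 0.
have N0 : (0 < 2 ^ k)%N by rewrite expn_gt0.
have [x [x0 xr hx]] := reflected_solve (no_trap_initial (k := k))
  (fun l => if l is 0 then Bm *m e else 0).
pose x' l := if l is 0 then e else x l.
have hx' l : (l < 2 ^ k)%N -> harmonic_at Bm B0 Bp x' l.
  move=> hl; rewrite /harmonic_at /x'; case: l hl => [|l] hl; rewrite [RHS](hx _ hl).
    by rewrite x0 mulmx0 add0r addrA.
  by rewrite add0r.
have xr' : reflected Gt (2 ^ k) x'.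
  by rewrite /reflected /x'; case: (2 ^ k)%N N0 xr.
have e0 : 0 <=m e by move=> c d; rewrite !mxE ler0n.
have x1 : 0 <=m x' 1%N.
  apply: (reflected_ge0 hBm hB0 hBp hB hGt (no_trap_initial (k := k))) => // l hl.
  by rewrite [X in X <=m _](hx' l hl); exact: lemx_refl.
have := transfer hx'; rewrite [x' (2 ^ k).+1]xr' subrr mulmx0 => /eqP.
rewrite subr_eq0 subr_eq -mulmxDl addrC => /eqP h.
have := x1 a 0; rewrite h mxE [X in _ <= X](_ : _ = U k a i) //.
rewrite mxE (bigD1 i) //= big1 => [|j ji]; first by rewrite !mxE !eqxx mulr1 addr0 addrC.
by rewrite [e _ _]mxE (negbTE ji) mulr0.
Qed.

(** Extend by G^j above the top level and apply the maximum principle. *)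
Lemma no_trap_G N : no_trap Bm B0 Bp G N.
Proof.
move=> x x0 xr hx l hl.
pose f j := if (j <= N)%N then x j else G ^+ (j - N) *m x N.
have fE j : (j <= N.+1)%N -> f j = x j.
  rewrite leq_eqVlt => /orP[/eqP ->|]; last by rewrite ltnS /f => ->.
  by rewrite /f ltnn subSnn expr1 xr.
have fG j : (N <= j)%N -> f j = G ^+ (j - N) *m x N.
  rewrite leq_eqVlt => /orP[/eqP <-|]; last by rewrite ltnNge /f => /negbTE ->.
  by rewrite /f leqnn subnn expr0 mul1mx.
have fh j : harmonic_at Bm B0 Bp f j.
  have [jN|Nj] := ltnP j N.
    by rewrite /harmonic_at !fE ?hx //; lia.
  rewrite /harmonic_at !fG; try lia.
  have := harmonic_mulr (x N) (Gharm (j - N)).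
  by rewrite /harmonic_at -!subSn //; lia.
pose c := \sum_(j < N.+1) \sum_i `|x j i 0|.
have xc j i : (j <= N)%N -> `|x j i 0| <= c.
  move=> jN; rewrite /c (bigD1 (Ordinal (jN : (j < N.+1)%N))) //= (bigD1 i) //= -addrA.
  by rewrite lerDl addr_ge0 // sumr_ge0 // => *; rewrite sumr_ge0.
have [G0 _ _] := minG.
have bnd j i : `|f j i 0| <= c.
  have [jN|Nj] := leqP j N; first by rewrite /f jN xc.
  rewrite fG ?(ltnW Nj) // ler_norml; apply/andP; split.
    rewrite lerNl -entryN -mulmxN; apply: mul_sto_bound; first exact: nonneg_mxX.
      exact: expr_vec1.
    move=> a; rewrite entryN; apply: le_trans (xc N a (leqnn _)).
    by rewrite -normrN; exact: ler_norm.
  apply: mul_sto_bound; first exact: nonneg_mxX.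
    exact: expr_vec1.
  by move=> a; apply: le_trans (xc N a (leqnn _)); exact: ler_norm.
have f1 := harmonic_bounded hBm hB0 hBp hB minG hG1 bnd fh.
suff f0 : f l = 0 by rewrite -fE // leqW.
elim: (l) => [|m IH]; first by rewrite fE.
by rewrite f1 IH mulmx0.
Qed.

Let V0 : nonneg_mx V. Proof. by case: minV. Qed.
Let eV : qbd_solution Bp B0 Bm V. Proof. by case: minV. Qed.
Let V1le : V *m vec1 R n <=m vec1 R n.
Proof. exact: (V_le1 hBm hB0 hBp hB minV). Qed.

(** Transfer along V^(N+1-j). *)
Lemma F_down k : F k *m (1%:M - Gt *m V) = (1%:M - U k *m V) *m V ^+ (2 ^ k).
Proof.
have h l : (l < 2 ^ k)%N -> harmonic_at Bm B0 Bp (fun j => V ^+ ((2 ^ k).+1 - j) *m 1%:M) l.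
  exact: harmonic_V.
have := transfer h; rewrite !mulmx1 subnn subSnn subn0 subSS subn0 expr0 expr1 => <-.
by rewrite exprS mulmxBl mul1mx mulmxDl mulmxDl opprD addrA !mulmxA.
Qed.

(** Reflected transfer along V^(N+1-j). *)
Lemma Psi_down k : Psi k *m (1%:M - U k *m V) = (1%:M - U k.+1 *m V) *m V ^+ (2 ^ k).
Proof.
have h l : (l < 2 ^ k)%N -> harmonic_at Bm B0 Bp (fun j => V ^+ ((2 ^ k).+1 - j) *m 1%:M) l.
  exact: harmonic_V.
have := transfer_up h; rewrite !mulmx1 subnn subSnn subn0 subSS subn0 expr0 expr1 => <-.
by rewrite exprS mulmxBl mul1mx mulmxDl mulmxDl opprD addrA !mulmxA.
Qed.

Section Drift.
Variable u : 'cV[R]_n.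
Hypothesis poisson : (Bm + B0 + Bp) *m u + Bp *m vec1 R n = u + Bm *m vec1 R n.

Let linear_harmonic l : harmonic_at Bm B0 Bp (fun j => u + j%:R *: vec1 R n) l.
Proof.
rewrite /harmonic_at.
transitivity (((Bm + B0 + Bp) *m u + Bp *m vec1 R n) - Bm *m vec1 R n
  + l.+1%:R *: ((Bm + B0 + Bp) *m vec1 R n)).
  by rewrite !mulmxDr !mulmxDl -!scalemxAr -!natr1; mx_abel.
by rewrite poisson hB; mx_abel.
Qed.

(** Transfer along u + j 1, for which y_j = 1 + u - Gt u does not depend on j.
    *)
Lemma F_drift k : F k *m (vec1 R n + u - Gt *m u) = vec1 R n + u - U k *m u.
Proof.
have [_ Gt1] := hGt.
have := @transfer _ (fun j => u + j%:R *: vec1 R n) k (fun l _ => linear_harmonic l).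
rewrite scale0r addr0 scale1r => h.
have -> : vec1 R n + u - Gt *m u = u + (2 ^ k).+1%:R *: vec1 R n -
    Gt *m (u + (2 ^ k)%N%:R *: vec1 R n).
  by rewrite mulmxDr -scalemxAr Gt1 -natr1; mx_abel.
by rewrite -h mulmxDl; mx_abel.
Qed.

(** Reflected transfer along u + j 1. *)
Lemma Psi_drift k : Psi k *m (vec1 R n + u - U k *m u) = vec1 R n + u - U k.+1 *m u.
Proof.
have [_ U1] := SDA_stochastic k.
have := @transfer_up _ (fun j => u + j%:R *: vec1 R n) k (fun l _ => linear_harmonic l).
rewrite scale0r addr0 scale1r => h.
have -> : vec1 R n + u - U k *m u = u + (2 ^ k).+1%:R *: vec1 R n -
    U k *m (u + (2 ^ k)%N%:R *: vec1 R n).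
  by rewrite mulmxDr -scalemxAr U1 -natr1; mx_abel.
by rewrite -h mulmxDl; mx_abel.
Qed.

End Drift.

Lemma often_pow2 X : (forall k, no_trap Bm B0 Bp X (2 ^ k)) ->
  forall N0, exists2 N, (N0 <= N)%N & no_trap Bm B0 Bp X N.
Proof. by move=> h N0; exists (2 ^ N0)%N => //; apply: ltnW; exact: ltn_expl. Qed.

Lemma UV_bound k : entry_norm (1%:M - U k *m V) <= n%:R + n%:R * n%:R.
Proof.
apply: le_trans (entry_normD _ _) _; rewrite entry_normN; apply: lerD.
  apply: substochastic_norm; first exact: nonneg_mx1.
  by rewrite mul1mx; exact: lemx_refl.
have [U0 U1] := SDA_stochastic k.
apply: le_trans (entry_normM _ _) _; apply: ler_pM; rewrite ?entry_norm_ge0 //.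
  by apply: substochastic_norm => //; rewrite U1; exact: lemx_refl.
exact: substochastic_norm.
Qed.

Lemma F_bound_transient : spectral_radius V < 1 ->
  exists2 C, 0 <= C & forall k, entry_norm (F k) <= C * entry_norm (V ^+ (2 ^ k)).
Proof.
move=> rho1.
have [[z ez zr] rmax] := spectral_radius_attained V (leq_ltn_trans (leq0n i0) (ltn_ord i0)).
have rho0 : 0 <= spectral_radius V by rewrite -zr cmod_ge0.
pose r := (1 + spectral_radius V) / 2.
have r0 : 0 < r by rewrite /r; lra.
have r1 : r < 1 by rewrite /r; lra.
have [C C0 hC] : exists2 C, 0 <= C & forall m i j, `|(V ^+ m) i j| <= C * r ^+ m.
  apply: power_growth_real => // w /rmax; rewrite /r; lra.
have uZ : 1%:M - Gt *m V \in unitmx.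
  apply: (unit_of_transient hBm hB0 hBp hB hGt V0 V1le eV).
    exact: often_pow2 no_trap_initial.
  by move=> i j; apply: (@geometric_cvg0 _ _ C r) => //; exact: ltW.
exists ((n%:R + n%:R * n%:R) * entry_norm (invmx (1%:M - Gt *m V))).
  by rewrite mulr_ge0 ?entry_norm_ge0 ?addr_ge0 ?mulr_ge0.
move=> k; rewrite -[F k](mulmxK uZ) F_down.
apply: le_trans (entry_normM _ _) _; rewrite mulrAC.
apply: ler_wpM2r; first exact: entry_norm_ge0.
apply: le_trans (entry_normM _ _) _; apply: ler_wpM2r; first exact: entry_norm_ge0.
exact: UV_bound.
Qed.

Hypothesis hmod1 : forall z : R[i], eigenvalue (cmx G) z -> cmod z = 1 -> z = 1.
Hypothesis simple1 : forall x : 'cV[R[i]]_n, cmx G *m x = x ->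
  exists a, x = a *: vec1 _ n.

Section NullRecurrent.
Hypothesis tau1 : spectral_radius V = 1.

Let V1 : V *m vec1 R n = vec1 R n.
Proof. exact: (V_stochastic hBm hB0 hBp hB minG minV hG1 hmod1 simple1 i0 tau1). Qed.

(** All rows of V^m become equal, since V deflated at 1 has spectral radius
    less than 1. *)
Lemma V_rows_cvg i i' j : (fun m => (V ^+ m) i j - (V ^+ m) i' j) @ \oo --> (0 : R).
Proof.
have sV : stochastic V by split.
have [C [r [C0 r0 r1 h]]] := deflated_growth_lt1 i0 sV
  (V_deflated_spectrum hBm hB0 hBp hB minG minV hG1 hmod1 simple1).
apply: (@geometric_cvg0 _ _ (2 * C) r) => //; first exact: ltW.
move=> m /=; apply: (le_trans (deflator_rows V i0 m i i' j)).
by rewrite -mulrA; apply: ler_wpM2l.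
Qed.

Lemma null_recurrent_u : exists u : 'cV[R]_n,
  (Bm + B0 + Bp) *m u + Bp *m vec1 R n = u + Bm *m vec1 R n.
Proof.
apply: (null_recurrent_poisson i0 hBm hB0 hBp hB minG minV hG1 V1).
exact: (harmonic_constant hBm hB0 hBp hB minG hG1 simple1).
Qed.

Lemma null_recurrent_rows X : stochastic X -> (forall k, no_trap Bm B0 Bp X (2 ^ k)) ->
  exists (u : 'cV[R]_n) (T : 'M[R]_(n + 1, n)),
  (Bm + B0 + Bp) *m u + Bp *m vec1 R n = u + Bm *m vec1 R n /\
  row_mx (1%:M - X *m V) (vec1 R n + u - X *m u) *m T = 1%:M.
Proof.
move=> sX hX; have [u pu] := null_recurrent_u; exists u.
have /row_freeP[T hT] := recurrent_row_free hBm hB0 hBp hB sX V0 V1le eV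
  (often_pow2 hX) V1 V_rows_cvg minV pu.
by exists T.
Qed.

Let bound_row u k m : entry_norm (row_mx ((1%:M - U k *m V) *m V ^+ m) (vec1 R n + u - U k *m u))
  <= (n%:R + n%:R * n%:R) * n%:R + (entry_norm (vec1 R n + u) + n%:R * entry_norm u).
Proof.
have [U0 U1] := SDA_stochastic k.
rewrite entry_norm_row_mx; apply: lerD.
  apply: le_trans (entry_normM _ _) _; apply: ler_pM; rewrite ?entry_norm_ge0 ?UV_bound //.
  apply: substochastic_norm; first exact: nonneg_mxX.
  exact: expr_sub_vec1.
apply: le_trans (entry_normD _ _) _; rewrite lerD2l entry_normN.
apply: le_trans (entry_normM _ _) _; apply: ler_wpM2r; first exact: entry_norm_ge0.
by apply: substochastic_norm => //; rewrite U1; exact: lemx_refl.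
Qed.

Lemma F_bound_recurrent : exists2 C, 0 <= C & forall k, entry_norm (F k) <= C.
Proof.
have [u [T [pu hT]]] := null_recurrent_rows hGt no_trap_initial.
exists (((n%:R + n%:R * n%:R) * n%:R + (entry_norm (vec1 R n + u) + n%:R * entry_norm u))
  * entry_norm T).
  by rewrite mulr_ge0 ?entry_norm_ge0 // !addr_ge0 ?mulr_ge0 ?addr_ge0 ?mulr_ge0 ?entry_norm_ge0.
move=> k; rewrite -[F k]mulmx1 -hT mulmxA mul_mx_row F_down (F_drift pu).
apply: le_trans (entry_normM _ _) _; apply: ler_wpM2r; first exact: entry_norm_ge0.
exact: bound_row.
Qed.

(** The rows [I - U_k V, 1 + u - U_k u] tend to the rows built with G, which
    have a right inverse T; for k large, multiplying by T gives a perturbation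
    of the identity of size at most 1/2. *)
Lemma Psi_bound_recurrent : (fun k => entry_norm (H - P k)) @ \oo --> (0 : R) ->
  exists2 C, 0 <= C & \forall k \near \oo, entry_norm (Psi k) <= C.
Proof.
move=> Hcvg; have [G0 _ _] := minG.
have sG : stochastic G by split.
have [u [T [pu hT]]] := null_recurrent_rows sG (fun k => @no_trap_G (2 ^ k)).
set K := (n%:R + n%:R * n%:R) * n%:R + (entry_norm (vec1 R n + u) + n%:R * entry_norm u).
have K0 : 0 <= K.
  by rewrite /K !addr_ge0 ?mulr_ge0 ?addr_ge0 ?mulr_ge0 ?entry_norm_ge0.
exists (2 * (K * entry_norm T)).
  by rewrite !mulr_ge0 ?entry_norm_ge0.
pose L := (entry_norm V + entry_norm u) * entry_norm T.
have L0 : 0 <= L by rewrite mulr_ge0 ?addr_ge0 ?entry_norm_ge0.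
have small : \forall k \near \oo, entry_norm (H - P k) < (2 * (L + 1))^-1.
  by apply: (cvgr_lt _ Hcvg); rewrite invr_gt0; lra.
apply: filterS small => k small.
pose Wk := row_mx (1%:M - U k *m V) (vec1 R n + u - U k *m u).
have PW : Psi k *m Wk = row_mx ((1%:M - U k.+1 *m V) *m V ^+ (2 ^ k))
    (vec1 R n + u - U k.+1 *m u).
  by rewrite mul_mx_row Psi_down (Psi_drift pu).
(* the rows built with U_k differ from those built with G by a multiple of
   H - P_k *)
have WT : Wk *m T = 1%:M + row_mx ((H - P k) *m V) ((H - P k) *m u) *m T.
  rewrite -hT -mulmxDl add_row_mx; congr (row_mx _ _ *m _).
    by rewrite /U /H !mulmxBl !mulmxDl; mx_abel.
  by rewrite /U /H !mulmxBl !mulmxDl; mx_abel.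
have e : Psi k = Psi k *m Wk *m T - Psi k *m (row_mx ((H - P k) *m V) ((H - P k) *m u) *m T).
  by rewrite -mulmxA WT mulmxDr mulmx1 addrK.
have d : entry_norm (row_mx ((H - P k) *m V) ((H - P k) *m u) *m T) <= 2^-1.
  apply: le_trans (entry_normM _ _) _.
  apply: (@le_trans _ _ (entry_norm (H - P k) * L)).
    rewrite /L mulrA; apply: ler_wpM2r; first exact: entry_norm_ge0.
    by rewrite entry_norm_row_mx mulrDr; apply: lerD; exact: entry_normM.
  apply: (@le_trans _ _ ((2 * (L + 1))^-1 * L)); first by apply: ler_wpM2r => //; exact: ltW.
  rewrite mulrC ler_pdivrMr; last by lra.
  by rewrite mulrA mulVf // mul1r; lra.
have : entry_norm (Psi k) <= K * entry_norm T + entry_norm (Psi k) * 2^-1.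
  rewrite {1}e; apply: le_trans (entry_normD _ _) _; rewrite entry_normN; apply: lerD.
    rewrite PW; apply: le_trans (entry_normM _ _) _.
    by apply: ler_wpM2r; [exact: entry_norm_ge0|exact: bound_row].
  apply: le_trans (entry_normM _ _) _; apply: ler_wpM2l => //; exact: entry_norm_ge0.
lra.
Qed.

End NullRecurrent.

End SDAAnalysis.

(** * Norms on complex vectors *)

Section NormEquivalence.
Variables (R : realType) (n : nat) (N : 'cV[R[i]]_n -> R).
Hypothesis hN : vector_norm N.

Definition coord_norm (x : 'cV[R[i]]_n) : R := \sum_i cmod (x i 0).

Lemma vnorm0 : N 0 = 0.
Proof. by have [_ _ NZ] := hN; rewrite -(scale0r (0 : 'cV_n)) NZ cmod0 mul0r. Qed.

Lemma vnormN x : N (- x) = N x.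
Proof. by have [_ _ NZ] := hN; rewrite -scaleN1r NZ cmodN cmod1 mul1r. Qed.

Lemma vnorm_ge0 x : 0 <= N x.
Proof.
have [_ ND _] := hN; have := ND x (- x).
by rewrite subrr vnorm0 vnormN; lra.
Qed.

Lemma vnorm_sum (I : Type) (r : seq I) (f : I -> 'cV[R[i]]_n) :
  N (\sum_(i <- r) f i) <= \sum_(i <- r) N (f i).
Proof.
have [_ ND _] := hN.
elim: r => [|a r IH]; first by rewrite !big_nil vnorm0.
by rewrite !big_cons; apply: le_trans (ND _ _) _; rewrite lerD2l.
Qed.

Lemma vnorm_le_coord : exists2 C, 0 <= C & forall x, N x <= C * coord_norm x.
Proof.
have [_ ND NZ] := hN.
exists (\sum_i N (delta_mx i 0)); first by apply: sumr_ge0 => *; exact: vnorm_ge0.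
move=> x; rewrite {1}[x]matrix_sum_delta.
under eq_bigr do rewrite big_ord1.
apply: le_trans (vnorm_sum _ _) _; rewrite mulr_suml; apply: ler_sum => i _.
rewrite NZ mulrC; apply: ler_wpM2l; first exact: vnorm_ge0.
by rewrite /coord_norm (bigD1 i) //= lerDl; apply: sumr_ge0 => *; exact: cmod_ge0.
Qed.

Let phi (v : 'rV[R]_(n + n)) : 'cV[R[i]]_n :=
  \col_i (v 0 (lshift n i) +i* v 0 (rshift n i))%C.

Let phiB v w : phi (v - w) = phi v - phi w.
Proof. by apply/matrixP => i j; rewrite !mxE. Qed.

Let phi_norm v : coord_norm (phi v) <= (2 * n%:R) * `|v|.
Proof.
rewrite /coord_norm.
apply: (@le_trans _ _ (\sum_(i < n) 2 * `|v|)); last first.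
  by rewrite sumr_const card_ord -[_ *+ n]mulr_natr [leLHS]mulrAC lexx.
have ent i : `|v 0 i| <= `|v|.
  by rewrite [leRHS]/Num.norm /= mx_normrE; apply/bigmax_geP; right => /=; exists (0, i).
apply: ler_sum => i _; rewrite mxE.
set a := v 0 _; set b := v 0 _.
have -> : (a +i* b)%C = a%:C%C + 'i%C * b%:C%C by rewrite [LHS]complexE.
apply: le_trans (cmodD _ _) _; rewrite cmodM !cmod_real.
have -> : cmod ('i%C : R[i]) = 1.
  by apply: complexI; rewrite cmodC normc_def /= expr0n expr1n add0r sqrtr1.
rewrite mul1r; have := ent (lshift n i); have := ent (rshift n i).
rewrite -/a -/b; lra.
Qed.

Let phi_inj v : phi v = 0 -> v = 0.
Proof.
move=> /matrixP h; apply/matrixP => i j; rewrite ord1 mxE.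
case: (split_ordP j) => k ->.
  by have := h k 0; rewrite !mxE => -[].
by have := h k 0; rewrite !mxE => -[].
Qed.

Let phi_surj x : exists v, phi v = x.
Proof.
exists (row_mx (\row_i complex.Re (x i 0)) (\row_i complex.Im (x i 0))).
apply/matrixP => i j; rewrite ord1 mxE row_mxEl row_mxEr !mxE.
by case: (x i 0).
Qed.

Let Nphi_cont : continuous (fun v => N (phi v)).
Proof.
have [C C0 hC] := vnorm_le_coord; have [_ ND _] := hN.
pose K := C * (2 * n%:R) + 1.
have K0 : 0 < K by rewrite ltr_wpDl // !mulr_ge0.
have lip v w : `|N (phi v) - N (phi w)| <= K * `|v - w|.
  have sub x y : N x - N y <= N (x - y).
    by have := ND (x - y) y; rewrite subrK; lra.
  have h : N (phi v - phi w) <= K * `|v - w|.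
    rewrite -phiB; apply: le_trans (hC _) _; rewrite /K mulrDl mul1r.
    apply: (@le_trans _ _ (C * (2 * n%:R * `|v - w|))).
      by apply: ler_wpM2l.
    by have : 0 <= `|v - w| by []; lra.
  have := sub (phi v) (phi w); have := sub (phi w) (phi v).
  have -> : N (phi w - phi v) = N (phi v - phi w) by rewrite -vnormN opprB.
  by rewrite ler_norml => *; apply/andP; split; lra.
move=> v; apply/(@cvgrPdist_lt _ _ _ (nbhs v)) => e e0.
near=> w; apply: le_lt_trans (lip _ _) _.
rewrite mulrC -ltr_pdivlMr //; near: w.
exact: (@cvgr_dist_lt _ _ _ (nbhs v) _ id v (@cvg_id _ _) _ (divr_gt0 e0 K0)).
Unshelve. all: by end_near. Qed.

(** N attains a positive minimum on the unit sphere of the real coordinate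
    space of dimension 2n, which is compact. *)
Lemma coord_le_vnorm : exists2 C, 0 <= C & forall x, coord_norm x <= C * N x.
Proof.
have [N0 ND NZ] := hN.
have [n0|n0] := posnP n.
  exists 0 => // x; rewrite /coord_norm mul0r big1 // => i.
  by have := ltn_ord i; rewrite {2}n0.
pose A : set 'rV[R]_(n + n) := [set v | `|v| = 1].
have cA : compact A.
  apply: bounded_closed_compact.
    by exists 1; split=> // B B1 v /= ->; exact: ltW.
  apply: (preimage_closed (f := fun v : 'rV[R]_(n + n) => `|v|) (D := [set x | x = 1])).
    by move=> v _; exact: norm_continuous.
  exact: closed_eq.
have A0 : A !=set0.
  have k0 : (0 < n + n)%N by rewrite addn_gt0 n0.
  pose d : 'rV[R]_(n + n) := const_mx 1.
  have dn : `|d| != 0.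
    rewrite normr_eq0; apply/negP => /eqP /matrixP /(_ 0 (Ordinal k0)).
    by rewrite !mxE => /eqP; rewrite oner_eq0.
  exists (`|d|^-1 *: d); rewrite /A /= normrZ ger0_norm ?invr_ge0 //.
  by rewrite mulVf.
have [v vA vmin] : exists2 c, c \in A & forall t, t \in A -> N (phi c) <= N (phi t).
  apply: compact_EVT_min => //; apply: continuous_subspaceT; exact: Nphi_cont.
have m0 : 0 < N (phi v).
  rewrite lt_neqAle vnorm_ge0 andbT eq_sym; apply/negP => /eqP/N0/phi_inj v0.
  by move: vA; rewrite inE /A /= v0 normr0 => /esym/eqP; rewrite oner_eq0.
exists (2 * n%:R / N (phi v)); first by rewrite divr_ge0 ?mulr_ge0 // ltW.
move=> x; have [w <-] := phi_surj x.
have [->|w0] := eqVneq w 0.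
  have -> : phi 0 = 0 by apply/matrixP => i j; rewrite !mxE.
  rewrite vnorm0 mulr0 /coord_norm big1 // => i _; by rewrite mxE cmod0.
apply: le_trans (phi_norm w) _; rewrite -[leRHS]mulrA; apply: ler_wpM2l; first by rewrite mulr_ge0.
rewrite mulrC ler_pdivlMr //.
have wn : `|w| != 0 by rewrite normr_eq0.
have tA : `|w|^-1 *: w \in A.
  by rewrite inE /A /= normrZ ger0_norm ?invr_ge0 // mulVf.
have pw : phi w = (`|w|%:C)%C *: phi (`|w|^-1 *: w).
  apply/matrixP => i j; rewrite ord1 !mxE /= [RHS]/GRing.mul /= !mul0r subr0 addr0.
  by rewrite !mulrA divff // !mul1r.
rewrite pw NZ cmod_real normr_id; apply: ler_wpM2l => //; exact: vmin.
Qed.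

Lemma coord_normM (A : 'M[R]_n) x : coord_norm (cmx A *m x) <= entry_norm A * coord_norm x.
Proof.
rewrite /coord_norm /entry_norm mulr_suml; apply: ler_sum => i _.
rewrite mxE; apply: le_trans (cmod_sum _ _) _.
rewrite mulr_suml; apply: ler_sum => j _; rewrite cmodM mxE cmod_real.
apply: ler_wpM2l => //.
by rewrite (bigD1 j) //= lerDl; apply: sumr_ge0 => *; exact: cmod_ge0.
Qed.

Lemma vnorm_mul_bound : exists2 C, 0 <= C &
  forall (A : 'M[R]_n) x, N (cmx A *m x) <= C * entry_norm A * N x.
Proof.
have [C1 C10 h1] := vnorm_le_coord; have [C2 C20 h2] := coord_le_vnorm.
exists (C1 * C2); first exact: mulr_ge0.
move=> A x; apply: le_trans (h1 _) _; rewrite -!mulrA; apply: ler_wpM2l => //.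
apply: le_trans (coord_normM _ _) _; rewrite mulrCA; apply: ler_wpM2l => //.
exact: entry_norm_ge0.
Qed.

Let unit_values (A : 'M[R]_n) :=
  [set N (cmx A *m x) | x in [set x : 'cV[R[i]]_n | N x <= 1]].

Let unit_values0 A : unit_values A 0.
Proof. by exists 0; rewrite /= ?vnorm0 ?ler01 // mulmx0 vnorm0. Qed.

(** The set whose supremum defines the operator norm is bounded, by
    equivalence of norms. *)
Lemma opnorm_le_entry : exists2 C, 0 <= C & forall A, opnorm N A <= C * entry_norm A.
Proof.
have [C C0 h] := vnorm_mul_bound; exists C => // A.
apply: ge_sup; first by exists 0; exact: unit_values0.
move=> _ [x /= x1 <-]; apply: le_trans (h A x) _.
by rewrite -[leRHS]mulr1; apply: ler_wpM2l => //; rewrite mulr_ge0 ?entry_norm_ge0.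
Qed.

Lemma unit_values_le_opnorm (A : 'M[R]_n) x : N x <= 1 -> N (cmx A *m x) <= opnorm N A.
Proof.
have [C C0 h] := vnorm_mul_bound => x1; apply: ub_le_sup; last by exists x.
exists (C * entry_norm A) => _ [w /= w1 <-]; apply: le_trans (h A w) _.
by rewrite -[leRHS]mulr1; apply: ler_wpM2l => //; rewrite mulr_ge0 ?entry_norm_ge0.
Qed.

Lemma opnorm_ge0 A : 0 <= opnorm N A.
Proof.
by have := @unit_values_le_opnorm A 0; rewrite mulmx0 vnorm0 ler01; apply.
Qed.

Lemma entry_le_opnorm : exists2 C, 0 <= C & forall A, entry_norm A <= C * opnorm N A.
Proof.
have [N0 ND NZ] := hN; have [C C0 h] := coord_le_vnorm.
exists (\sum_(j < n) C * N (delta_mx j 0)).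
  by apply: sumr_ge0 => j _; rewrite mulr_ge0 // vnorm_ge0.
move=> A; rewrite /entry_norm exchange_big /= mulr_suml; apply: ler_sum => j _.
set e : 'cV[R[i]]_n := delta_mx j 0.
have e0 : 0 < N e.
  rewrite lt_neqAle vnorm_ge0 andbT eq_sym; apply/negP => /eqP/N0/matrixP /(_ j 0).
  by rewrite !mxE !eqxx => /eqP; rewrite oner_eq0.
have -> : \sum_i `|A i j| = coord_norm (cmx A *m e).
  apply: eq_bigr => i _; rewrite mxE (bigD1 j) //= big1 => [|k kj].
    by rewrite !mxE !eqxx mulr1 addr0 cmod_real.
  by rewrite [e _ _]mxE (negbTE kj) mulr0.
apply: le_trans (h _) _; rewrite -mulrA; apply: ler_wpM2l => //.
pose w := ((N e)^-1%:C)%C *: e.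
have w1 : N w <= 1 by rewrite NZ cmod_real ger0_norm ?mulVf ?gt_eqF // invr_ge0 ltW.
have ew : e = ((N e)%:C)%C *: w by rewrite scalerA -rmorphM divff ?gt_eqF // scale1r.
rewrite {1}ew -scalemxAr NZ cmod_real gtr0_norm //; apply: ler_wpM2l; first exact: ltW.
exact: unit_values_le_opnorm.
Qed.

End NormEquivalence.

(** * Root tests and diagonalization *)

Lemma limn_esup_le_near (R : realType) (u : (\bar R)^nat) (M : \bar R) :
  (\forall k \near \oo, (u k <= M)%E) -> (limn_esup u <= M)%E.
Proof.
move=> [m0 _ h]; rewrite limn_esup_lim; apply: lime_le; first exact: is_cvg_esups.
exists m0 => // m /= hm; apply: ge_ereal_sup => _ [k /= hk <-].
by apply: h => /=; exact: leq_trans hk.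
Qed.

Lemma geometric_eventually_le1 (R : realType) (C t : R) : 0 <= t -> t < 1 ->
  exists m0, forall m, (m0 <= m)%N -> C * t ^+ m <= 1.
Proof.
move=> t0 t1.
have c : (fun m => C * t ^+ m) @ \oo --> (0 : R).
  rewrite -[X in _ --> X](mulr0 C); apply: cvgM; first exact: cvg_cst.
  by apply: cvg_expr; rewrite ger0_norm.
have [m0 _ h] := cvgr_lt _ c _ (ltr01 : (0 : R) < 1).
by exists m0 => m hm; apply/ltW/h.
Qed.

(** For s in (L, L + d) the factor C is eventually absorbed by ((L + d) /
    s)^(2^k). *)
Lemma limn_esup_root_le (R : realType) (e : nat -> R) (L : R) : 0 <= L ->
  (forall k, 0 <= e k) ->
  (forall s, L < s -> exists C, forall k, e k <= C * s ^+ (2 ^ k)) ->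
  (limn_esup (fun k => (e k `^ ((2 ^ k)%N%:R)^-1)%:E) <= L%:E)%E.
Proof.
move=> L0 e0 h; apply/lee_addgt0Pr => d d0.
have [|C hC] := h (L + d / 2); first by lra.
have s0 : 0 < L + d / 2 by lra.
have Ld0 : 0 < L + d by lra.
have [m0 hm0] : exists m0, forall m, (m0 <= m)%N ->
    C * ((L + d / 2) / (L + d)) ^+ m <= 1.
  apply: geometric_eventually_le1; first by rewrite divr_ge0 // ltW.
  by rewrite ltr_pdivrMr //; lra.
apply: limn_esup_le_near; exists m0 => // k /= hk.
have mk : (m0 <= 2 ^ k)%N by apply: leq_trans hk _; apply: ltnW; exact: ltn_expl.
have ek : e k <= (L + d) ^+ (2 ^ k).
  apply: le_trans (hC k) _; have := hm0 _ mk.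
  by rewrite expr_div_n mulrA ler_pdivrMr ?exprn_gt0 // mul1r.
rewrite -EFinD lee_fin.
apply: (@le_trans _ _ (((L + d) ^+ (2 ^ k)) `^ ((2 ^ k)%N%:R)^-1)).
  by apply: ge0_ler_powR; rewrite ?invr_ge0 ?nnegrE ?e0 ?exprn_ge0 // ltW.
rewrite -powR_mulrn; last exact: ltW.
rewrite -powRrM mulfV; last by rewrite pnatr_eq0 expn_eq0.
by rewrite powRr1 // ltW.
Qed.

Lemma split_rate (R : realType) (a b s : R) : 0 <= a -> 0 <= b -> a * b < s ->
  exists ra rb, [/\ a < ra, b < rb & ra * rb <= s].
Proof.
move=> a0 b0 h; pose d := Num.min 1 ((s - a * b) / (a + b + 1)).
have ab : 0 < a + b + 1 by lra.
have d0 : 0 < d by rewrite lt_min ltr01 divr_gt0 // subr_gt0.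
have d1 : d <= 1 by rewrite ge_min lexx.
have d2 : d * (a + b + 1) <= s - a * b.
  by rewrite -ler_pdivlMr // ge_min lexx orbT.
exists (a + d), (b + d); split; rewrite ?ltrDl //.
have : d * d <= d * 1 by apply: ler_wpM2l => //; exact: ltW.
by nra.
Qed.

Lemma expr_eigenvector (F : fieldType) n (A : 'M[F]_n) mu (w : 'cV[F]_n) m :
  A *m w = mu *: w -> A ^+ m *m w = mu ^+ m *: w.
Proof.
move=> Aw; elim: m => [|m IH]; first by rewrite !expr0 mul1mx scale1r.
by rewrite exprSr -mulmxA Aw -scalemxAr IH scalerA exprS.
Qed.

(** The columns of H S that belong to the eigenvalues larger than rho vanish;
    the others are multiplied by lam_j^m. *)
Lemma diagonalizable_growth (R : realType) n (G H : 'M[R]_n) (lam : nat -> R[i])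
    (S : 'M[R[i]]_n) (rho : R) : 0 <= rho ->
  S \in unitmx -> (forall j : 'I_n, cmx G *m col j S = lam j *: col j S) ->
  (forall j : 'I_n, cmx H *m col j S = 0 \/ cmod (lam j) <= rho) ->
  exists2 C, 0 <= C & forall m, entry_norm (H *m G ^+ m) <= C * rho ^+ m.
Proof.
move=> rho0 uS GS HS.
pose T := cmx H *m S.
have colM (A : 'M[R[i]]_n) j : col j (A *m S) = A *m col j S by rewrite !colE mulmxA.
have ent m i j : (cmx (H *m G ^+ m) *m S) i j = lam j ^+ m * T i j.
  have e : col j (cmx (H *m G ^+ m) *m S) = lam j ^+ m *: col j T.
    rewrite !colM cmxM cmxX -mulmxA (expr_eigenvector _ (GS j)).
    by rewrite -scalemxAr.
  by have := congr1 (fun M => fun_of_matrix M i 0) e; rewrite !mxE.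
have entle m (i j : 'I_n) : cmod (lam j ^+ m * T i j) <= cmod (T i j) * rho ^+ m.
  rewrite cmodM cmodX mulrC; case: (HS j) => [H0|h].
    have -> : T i j = 0.
      have e : col j T = 0 by rewrite colM.
      by have := congr1 (fun M => fun_of_matrix M i 0) e; rewrite !mxE.
    by rewrite cmod0 !mul0r.
  apply: ler_wpM2l; first exact: cmod_ge0.
  by apply: lerXn2r; rewrite ?nnegrE ?cmod_ge0.
exists (\sum_i \sum_l \sum_j cmod (T i j) * cmod (invmx S j l)).
  by do 3!(apply: sumr_ge0 => ? _); rewrite mulr_ge0 ?cmod_ge0.
move=> m; rewrite /entry_norm mulr_suml; apply: ler_sum => i _.
rewrite mulr_suml; apply: ler_sum => l _.
rewrite -cmod_real -[((H *m G ^+ m) i l)%:C%C]/(real_complex R _).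
have -> : real_complex R ((H *m G ^+ m) i l) =
    (cmx (H *m G ^+ m) *m S *m invmx S) i l by rewrite mulmxK // [RHS]mxE.
rewrite mxE; apply: le_trans (cmod_sum _ _) _; rewrite mulr_suml.
apply: ler_sum => j _; rewrite cmodM ent mulrAC.
by apply: ler_wpM2r; [exact: cmod_ge0|exact: entle].
Qed.

Lemma simple_eigenvector (F : fieldType) n (A : 'M[F]_n) (q : {poly F}) x :
  A *m vec1 F n = vec1 F n -> char_poly A = ('X - 1%:P) * q -> ~~ root q 1 ->
  A *m x = x -> exists a, x = a *: vec1 F n.
Proof.
case: n A x => [|n] A x A1 cA q1 Ax; last first.
  by exists (x 0 0); exact: simple_root_eigenvector A1 cA q1 Ax.
by exists 0; apply/matrixP => -[].
Qed.

Lemma eigenvalue_char (F : fieldType) n (A : 'M[F]_n) z :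
  eigenvalue A z -> root (char_poly A) z.
Proof.
case: n A => [|n] A; last by rewrite eigenvalue_root_char.
move=> /eigenvalue_colP[x xn0 _]; move/negP: xn0; case.
by apply/eqP/matrixP => -[].
Qed.

Lemma quad_qbd (R : realType) n (Bm B0 Bp X : 'M[R]_n) :
  quad_solution (- Bp) (1%:M - B0) (- Bm) X <-> X = Bm + B0 *m X + Bp *m X *m X.
Proof.
rewrite /quad_solution mulmxBl mul1mx !mulNmx.
have -> : - (Bp *m X *m X) + (X - B0 *m X) - Bm = X - (Bm + B0 *m X + Bp *m X *m X).
  by mx_abel.
by split=> [/eqP|e]; [rewrite subr_eq0 => /eqP|apply/eqP; rewrite subr_eq0; apply/eqP].
Qed.

Lemma minimal_quad_qbd (R : realType) n (Bm B0 Bp X : 'M[R]_n) :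
  minimal_nonneg_solution (quad_solution (- Bp) (1%:M - B0) (- Bm)) X ->
  minimal_nonneg_solution (qbd_solution Bm B0 Bp) X.
Proof.
move=> [X0 eX Xmin]; split=> // [|Y Y0 eY]; first exact/quad_qbd.
by apply: Xmin => //; exact/quad_qbd.
Qed.

(** * The convergence theorem *)

Theorem mainTheorem5 (R : realType) (n : nat)
  (Bm1 B0 B1 Am1 A0 A1 G V Gt H : 'M[R]_n)
  (hBm1 : nonneg_mx Bm1) (hB0 : nonneg_mx B0) (hB1 : nonneg_mx B1)
  (hB : (Bm1 + B0 + B1) *m vec1 R n = vec1 R n)
  (hAm1 : Am1 = - Bm1) (hA0 : A0 = 1%:M - B0) (hA1 : A1 = - B1)
  (hA0u : A0 \in unitmx)
  (hG : minimal_nonneg_solution (quad_solution A1 A0 Am1) G)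
  (hV : minimal_nonneg_solution (quad_solution Am1 A0 A1) V)
  (hrec : G *m vec1 R n = vec1 R n)
  (hmod1 : forall z : R[i], eigenvalue (cmx G) z -> cmod z = 1 -> z = 1)
  (sigma tau : R)
  (hsigma : sigma = spectral_radius G) (htau : tau = spectral_radius V)
  (lam : seq R[i])
  (hlam : char_poly (cmx G) = \prod_(z <- lam) ('X - z%:P))
  (hlam1 : lam`_0 = 1) (hlam2 : cmod lam`_1 < 1)
  (hlamord : forall i j : nat, (1 <= i <= j)%N -> (j < size lam)%N ->
     cmod lam`_j <= cmod lam`_i)
  (sigmat : R) (hsigmat : sigmat = cmod lam`_1)
  (hGt : stochastic Gt) (hH : H = G - Gt)
  (hinit : A0 + A1 *m Gt \in unitmx)
  (E F P Q : nat -> 'M[R]_n)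
  (hP0 : P 0%N = - (invmx (A0 + A1 *m Gt) *m
                     (A1 *m Gt *m Gt + A0 *m Gt + Am1)))
  (hE0 : E 0%N = Gt + P 0%N)
  (hF0 : F 0%N = - (invmx (A0 + A1 *m Gt) *m A1))
  (hQ0 : Q 0%N = F 0%N)
  (hSDA : SDA E F P Q)
  (N : 'cV[R[i]]_n -> R) (hN : vector_norm N) :
  [/\
    (* (a) *)
    H *m vec1 R n = 0 /\
    (forall k : nat,
      [/\ (H - P k) *m vec1 R n = F k *m H *m vec1 R n,
          F k *m H *m vec1 R n = 0,
          stochastic (Gt + P k) &
          P k *m vec1 R n = H *m vec1 R n]),
    (* (b) *)
    forall k : nat,
      H - P k = F k *m H *m G ^+ (2 ^ k) /\
      (forall (mu : R[i]) (w : 'cV[R[i]]_n),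
        w != 0 -> cmx G *m w = mu *: w -> mu != 1 ->
        cmx (F k *m H *m G ^+ (2 ^ k)) *m w
          = mu ^+ (2 ^ k) *: (cmx (F k *m H) *m w)),
    (* (c) *)
    [/\ (exists S : 'M[R[i]]_n, S \in unitmx /\
           forall j : 'I_n, cmx G *m col j S = lam`_j *: col j S) ->
        (exists gamma : R, forall (k : nat) (w : 'cV[R[i]]_n),
           N (cmx (H *m G ^+ (2 ^ k)) *m w)
             <= gamma * cmod lam`_1 ^+ (2 ^ k) * N w) /\
        ((exists c : R, forall j : nat, opnorm N (V ^+ j) <= c * tau ^+ j) ->
         exists gammat : R, forall k : nat,
           opnorm N (H - P k) <= gammat * (tau * sigmat) ^+ (2 ^ k)),
        (limn_esup (fun k : nat =>
           (opnorm N (H - P k) `^ ((2 ^ k)%N%:R)^-1)%:E)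
           <= (tau * sigmat)%:E)%E &
        0 < tau -> tau * sigmat < tau * sigma] &
    (* (d) *)
    tau = 1 -> sigma = 1 ->
    superlinear_to0 (fun k : nat => opnorm N (H - P k))
  ].

Proof.
subst Am1 A0 A1 sigma tau sigmat.
have minG := minimal_quad_qbd hG.
have minV := minimal_quad_qbd hV.
have eM : 1%:M - B0 + - B1 *m Gt = 1%:M - B0 - B1 *m Gt by rewrite mulNmx.
rewrite eM in hinit hP0 hF0.
have P0E : (1%:M - B0 - B1 *m Gt) *m P 0%N = B1 *m Gt *m Gt + (B0 - 1%:M) *m Gt + Bm1.
  by rewrite hP0 mulmxN mulKVmx // !mulmxBl !mulNmx; mx_abel.
have F0E : (1%:M - B0 - B1 *m Gt) *m F 0%N = B1.
  by rewrite hF0 mulmxN mulKVmx // opprK.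
have size_lam : size lam = n.
  by have := size_char_poly (cmx G); rewrite hlam size_prod_XsubC => -[].
have lam_gt0 : (0 < size lam)%N.
  by case: (lam) hlam1 => //= /esym/eqP; rewrite oner_eq0.
have n_gt0 : (0 < n)%N by rewrite -size_lam.
pose i0 := Ordinal n_gt0.
have lam_tail j : (0 < j < size lam)%N -> cmod lam`_j <= cmod lam`_1.
  by case/andP=> j0 jl; apply: hlamord => //; rewrite leqnn.
have lamE : lam = 1 :: behead lam by case: (lam) hlam1 lam_gt0 => //= a s ->.
have behead_lt1 z : z \in behead lam -> cmod z <= cmod lam`_1.
  move=> /(nthP 0)[j]; rewrite size_behead => jl <-; rewrite nth_behead.
  by apply: lam_tail; case: (size lam) jl.
(* 1 is a simple root, as the tail of lam stays in a disc of radius < 1 *)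
have simple1 (x : 'cV[R[i]]_n) : cmx G *m x = x -> exists a, x = a *: vec1 _ n.
  apply: (@simple_eigenvector _ _ _ (\prod_(z <- behead lam) ('X - z%:P))).
  - by rewrite -cmx_vec1 -cmxM hrec.
  - by rewrite hlam [in LHS]lamE big_cons.
  - rewrite root_prod_XsubC; apply/negP => /behead_lt1; rewrite cmod1.
    by rewrite leNgt hlam2.
have G_spec z : eigenvalue (cmx G) z -> z = 1 \/ cmod z <= cmod lam`_1.
  move=> /eigenvalue_char; rewrite hlam root_prod_XsubC [in X in X -> _]lamE inE.
  by case/orP => [/eqP|/behead_lt1]; [left|right].
have lam1_ge0 : 0 <= cmod lam`_1 by exact: cmod_ge0.
have G_growth r : cmod lam`_1 < r -> 
    exists2 C, 0 <= C & forall m, entry_norm (deflator R i0 *m G ^+ m) <= C * r ^+ m.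
  have sG : stochastic G by split=> //; case: minG.
  move=> hr; apply: (deflated_growth i0 sG) => [|mu x xn0 Gx].
    exact: le_lt_trans hr.
  have [mu1|] := G_spec mu ((eigenvalue_colP _ _).2 (ex_intro2 _ _ x xn0 Gx)).
    by left; apply: simple1; rewrite Gx mu1 scale1r.
  by move=> h; right; exact: le_lt_trans h hr.
have [[zV eV zVr] rmax] := spectral_radius_attained V n_gt0.
set tau := spectral_radius V in zVr rmax *.
have tau_ge0 : 0 <= tau by rewrite -zVr cmod_ge0.
have tau_le1 : tau <= 1.
  rewrite -zVr; exact: (V_spectrum_le1 hBm1 hB0 hB1 hB minV).
have errE := SDA_error minG hinit P0E hE0 F0E hQ0 hSDA.
have H1 : H *m vec1 R n = 0 by rewrite hH; exact: (H_vec1 hrec hGt).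
have P1 := SDA_P_vec1 minG hrec hGt hinit P0E hE0 F0E hQ0 hSDA.
have sU := SDA_stochastic hBm1 hB0 hB1 hB minG hrec hGt hinit P0E hE0 F0E hQ0 hSDA.
rewrite -hH in errE.
have Hdefl m : H *m G ^+ m = H *m (deflator R i0 *m G ^+ m).
  by rewrite mulmxA mul_deflator.
have FtrB := F_bound_transient i0 hBm1 hB0 hB1 hB minG minV hrec hGt hinit P0E hE0 F0E hQ0 hSDA.
have FrecB := F_bound_recurrent i0 hBm1 hB0 hB1 hB minG minV hrec hGt hinit P0E hE0 F0E hQ0 hSDA hmod1 simple1.
have [Co Co0 hCo] := opnorm_le_entry hN.
have [Ce Ce0 hCe] := entry_le_opnorm hN.
have F_rate ra : tau < ra -> exists2 C, 0 <= C & forall k, entry_norm (F k) <= C * ra ^+ (2 ^ k).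
  move=> hra; have ra0 : 0 < ra by exact: le_lt_trans hra.
  move: tau_le1; rewrite le_eqVlt => /orP[/eqP t1|t1].
    have [C C0 hC] := FrecB t1; exists C => // k; apply: le_trans (hC k) _.
    by rewrite ler_peMr // exprn_ege1 // -t1 ltW.
  have [C C0 hC] := FtrB t1.
  have [D D0 hD] := power_growth_real ra0 (fun z ez => le_lt_trans (rmax z ez) hra).
  have hD' := entry_norm_growth (ltW ra0) hD.
  exists (C * (D *+ n *+ n)); first by rewrite mulr_ge0 // !mulrn_wge0.
  by move=> k; apply: le_trans (hC k) _; rewrite -mulrA ler_wpM2l.
have err_rate ra rb : tau < ra -> cmod lam`_1 < rb -> exists2 C, 0 <= C &
    forall k, entry_norm (H - P k) <= C * (ra * rb) ^+ (2 ^ k).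
  move=> /F_rate[C C0 hC] /G_growth[D D0 hD].
  exists (C * entry_norm H * D); first by rewrite !mulr_ge0 ?entry_norm_ge0.
  move=> k; rewrite errE -mulmxA Hdefl.
  apply: le_trans (entry_normM _ _) _.
  apply: (@le_trans _ _ ((C * ra ^+ (2 ^ k)) * (entry_norm H * (D * rb ^+ (2 ^ k))))).
    apply: ler_pM; rewrite ?entry_norm_ge0 //.
    apply: le_trans (entry_normM _ _) _; apply: ler_wpM2l => //; exact: entry_norm_ge0.
  by rewrite exprMn le_eqVlt; apply/orP; left; apply/eqP; ring.
split.
- split=> // k; split=> //.
  + by rewrite mulmxBl H1 P1 subrr -mulmxA H1 mulmx0.
  + by rewrite -mulmxA H1 mulmx0.
  + by rewrite P1 H1.
- move=> k; split=> // mu w wn0 Gw mu1.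
  by rewrite cmxM cmxX -mulmxA (expr_eigenvector _ Gw) -scalemxAr.
- split.
  + move=> [S [uS GS]].
    have diag := @diagonalizable_growth R n G H (fun j => lam`_j) S (cmod lam`_1) lam1_ge0 uS GS.
    have [|D D0 hD] := diag.
      move=> j; case: (posnP j) => [j0|jpos]; last first.
        by right; apply: lam_tail; rewrite jpos size_lam ltn_ord.
      left; have [|a ->] := simple1 (col j S).
        by rewrite GS j0 hlam1 scale1r.
      by rewrite -scalemxAr -cmx_vec1 -cmxM H1 /cmx map_mx0 scaler0.
    split.
      have [C C0 hC] := vnorm_mul_bound hN.
      exists (C * D) => k w; apply: le_trans (hC _ _) _.
      apply: ler_wpM2r; first exact: vnorm_ge0.
      by rewrite -mulrA; apply: ler_wpM2l.
    move=> [c hc].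
    have [C C0 hC] : exists2 C, 0 <= C & forall k, entry_norm (F k) <= C * tau ^+ (2 ^ k).
      move: tau_le1; rewrite le_eqVlt => /orP[/eqP t1|t1].
        by have [C C0 hC] := FrecB t1; exists C => // k; rewrite t1 expr1n mulr1.
      have [C C0 hC] := FtrB t1.
      exists (C * (Ce * Num.max c 0)); first by rewrite !mulr_ge0 // le_max lexx orbT.
      move=> k; apply: le_trans (hC k) _; rewrite -mulrA; apply: ler_wpM2l => //.
      apply: le_trans (hCe _) _; rewrite -mulrA; apply: ler_wpM2l => //.
      apply: le_trans (hc _) _; apply: ler_wpM2r; first exact: exprn_ge0.
      by rewrite le_max lexx.
    exists (Co * (C * D)) => k; apply: le_trans (hCo _) _; rewrite -mulrA.
    apply: ler_wpM2l => //; rewrite errE -mulmxA; apply: le_trans (entry_normM _ _) _.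
    apply: (@le_trans _ _ ((C * tau ^+ (2 ^ k)) * (D * cmod lam`_1 ^+ (2 ^ k)))).
      by apply: ler_pM; rewrite ?entry_norm_ge0.
    by rewrite exprMn le_eqVlt; apply/orP; left; apply/eqP; ring.
  + apply: limn_esup_root_le; first exact: mulr_ge0.
      by move=> k; exact: opnorm_ge0.
    move=> s hs; have [ra [rb [hra hrb hab]]] := split_rate tau_ge0 lam1_ge0 hs.
    have [C C0 hC] := err_rate ra rb hra hrb.
    exists (Co * C) => k; apply: le_trans (hCo _) _; rewrite -mulrA; apply: ler_wpM2l => //.
    apply: le_trans (hC k) _; apply: ler_wpM2l => //.
    have ra0 : 0 <= ra by apply: le_trans (ltW hra).
    have rb0 : 0 <= rb by apply: le_trans (ltW hrb).
    by apply: lerXn2r; rewrite ?nnegrE ?mulr_ge0 // (le_trans _ hab) ?mulr_ge0.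
  + move=> tau0.
    suff rho1 : 1 <= spectral_radius G.
      by rewrite (ltr_pM2l tau0); exact: lt_le_trans hlam2 rho1.
    have [_ Gmax] := spectral_radius_attained G n_gt0.
    rewrite -(@cmod1 R); apply: Gmax; apply/eigenvalue_colP; exists (vec1 _ n).
      apply/negP => /eqP/matrixP/(_ i0 0); rewrite !mxE => /eqP.
      by rewrite oner_eq0.
    by rewrite -cmx_vec1 -cmxM hrec scale1r.
- move=> t1 _.
  (* the strict inequality |lam_1| < 1 leaves room for ra > tau = 1 and
     rb > |lam_1| with ra rb < 1 *)
  have [ra [rb [hra hrb hab]]] : exists ra rb, [/\ tau < ra, cmod lam`_1 < rb & ra * rb <= (1 + cmod lam`_1) / 2].
    by apply: split_rate => //; rewrite t1; lra.
  have ra0 : 0 <= ra by apply: le_trans (ltW hra).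
  have rb0 : 0 <= rb by apply: le_trans (ltW hrb).
  have ab0 : 0 <= ra * rb by exact: mulr_ge0.
  have ab1 : ra * rb < 1 by apply: le_lt_trans hab _; lra.
  have pow_le (t : R) k : 0 <= t -> t <= 1 -> t ^+ (2 ^ k) <= t ^+ k.
    move=> t0 tle1; rewrite -(subnKC (ltnW (ltn_expl k (ltnSn 1)))) exprD.
    by rewrite ler_piMr ?exprn_ge0 // exprn_ile1.
  have [C C0 hC] := err_rate ra rb hra hrb.
  have err_k k : entry_norm (H - P k) <= C * (ra * rb) ^+ k.
    by apply: le_trans (hC k) _; apply: ler_wpM2l => //; apply: pow_le => //; exact: ltW.
  have err0 : (fun k => entry_norm (H - P k)) @ \oo --> (0 : R).
    by apply: (@geometric_cvg0 _ _ C (ra * rb)) => // k; rewrite ger0_norm ?entry_norm_ge0.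
  split.
    apply: (@geometric_cvg0 _ _ (Co * C) (ra * rb)) => // k.
    rewrite ger0_norm ?opnorm_ge0 //; apply: le_trans (hCo _) _.
    by rewrite -mulrA ler_wpM2l.
  move=> eps eps0.
  rewrite hH in err0.
  have [K K0 hK] := Psi_bound_recurrent i0 hBm1 hB0 hB1 hB minG minV hrec hGt hinit P0E hE0 F0E hQ0 hSDA hmod1 simple1 t1 err0.
  pose r := (1 + cmod lam`_1) / 2.
  have r1 : r < 1 by rewrite /r; lra.
  have r0 : 0 <= r by rewrite /r; lra.
  have [D D0 hD] : exists2 D, 0 <= D & forall m, entry_norm (deflator R i0 *m G ^+ m) <= D * r ^+ m.
    by apply: G_growth; rewrite /r; lra.
  have [m0 hm0] := geometric_eventually_le1 (Co * K * Ce * D / eps) r0 r1.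
  have late : \forall k \near \oo, (m0 <= k)%N by exact: nbhs_infty_ge.
  near=> k.
  have Kk : entry_norm (F k *m invmx (1%:M - P k *m Q k)) <= K by near: k.
  have mk : (m0 <= k)%N by near: k.
  rewrite !ger0_norm ?opnorm_ge0 //; apply: le_trans (hCo _) _.
  have stepE := SDA_error_step minG hinit P0E hE0 F0E hQ0 hSDA k.
  rewrite -hH in stepE.
  have -> : H - P k.+1 = (F k *m invmx (1%:M - P k *m Q k)) *m
      ((H - P k) *m (deflator R i0 *m G ^+ (2 ^ k))).
    by rewrite stepE; congr (_ *m _); rewrite mulmxA mul_deflator // mulmxBl H1 P1 subrr.
  apply: (@le_trans _ _ (Co * (K * (Ce * opnorm N (H - P k) * (D * r ^+ k))))).
    apply: ler_wpM2l => //; apply: le_trans (entry_normM _ _) _.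
    apply: ler_pM; rewrite ?entry_norm_ge0 //; apply: le_trans (entry_normM _ _) _.
    apply: ler_pM; rewrite ?entry_norm_ge0 //.
    apply: le_trans (hD _) _; apply: ler_wpM2l => //; apply: pow_le => //; exact: ltW.
  have := hm0 k mk.
  have -> : Co * K * Ce * D / eps * r ^+ k = (Co * K * Ce * D * r ^+ k) / eps by ring.
  rewrite ler_pdivrMr // mul1r => h.
  have -> : Co * (K * (Ce * opnorm N (H - P k) * (D * r ^+ k))) =
     Co * K * Ce * D * r ^+ k * opnorm N (H - P k) by ring.
  by apply: ler_wpM2r => //; exact: opnorm_ge0.
Unshelve. all: by end_near. Qed.
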